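(* Let $m\geq 1$ be finite, let $\mathcal{A}_{m+1}=[m+1:\omega]$, and let $\bar a$ be a finite tuple from $\mathcal{A}_{m+1}$. For every oracle $Z\subseteq\omega$ there are $Z$-computable copies $\mathcal{B}_Z(\bar a),\mathcal{C}_Z(\bar a)\cong(\mathcal{A}_{m+1},\bar a)$ such that every isomorphism $f\colon\mathcal{B}_Z(\bar a)\to\mathcal{C}_Z(\bar a)$ satisfies $Z^{(2m)}\leq_T f$.
   Context: Trees. A tree is a structure $(T,\prec)$ in the language $\{\prec\}$ where $\prec$ is a strict partial order, the predecessors of each element form a finite linearly ordered set, and there is a $\prec$-least element, the root; trees are countable and have no infinite paths. The level of $x$ is its number of predecessors. Rank: terminal nodes have rank $0$, $\mathrm{rk}(x)=\sup\{\mathrm{rk}(y)+1: y$ an immediate successor of $x\}$, and the rank of $T$ is that of its root. For finite $n\geq1$ and $N\in\omega\cup\{\omega\}$ the tree type $[n:N]$ is defined inductively: $[1:N]$ is the tree of rank $\leq1$ whose root has exactly $N$ children; $[n:N]$ ($n\geq 2$) is the tree of rank $n$ in which exactly $N$ level-one nodes are roots of subtrees of type $[n-1:\omega]$, for every $k\in\omega$ (including $k=0$) infinitely many level-one nodes are roots of subtrees of type $[n-1:k]$, and there are no other level-one nodes. (''$\omega$ many'' and ''infinitely many'' mean countably infinitely many.) $(\mathcal{A}_{m+1},\bar a)$ is the expansion of $\mathcal{A}_{m+1}$ by constants naming the entries of $\bar a$ (repeats allowed); isomorphisms of such expansions respect the constants. A $Z$-computable copy is an isomorphic copy with $Z$-computable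 universe (a subset of $\omega$) and order. $Z^{(k)}$ is the $k$-th Turing jump of $Z$. *)

(* Defs.v *)
From Stdlib Require Cantor.
From mathcomp Require Import all_boot.
From mathcomp Require Import boolp classical_sets functions cardinality.

Set Implicit Arguments.
Unset Strict Implicit.
Unset Printing Implicit Defensive.

Local Open Scope classical_set_scope.
Local Open Scope card_scope.

Definition cpair (x y : nat) : nat := Cantor.to_nat (x, y).

(* Programs for unary partial functions on nat; several arguments are passed
   through the Cantor pairing [cpair]. *)
Inductive code : Type :=
| Czero | Csucc | Cfst | Csnd | Cquery
| Cpair of code & code
| Ccomp of code & code
| Cprec of code & code
| Cmu of code.

(* [eval X c x v]: program [c] with oracle [X] halts on input [x] with output
   [v]. [Cmu a] on [cpair x n] returns the least [k >= n] such that [a] returns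
   0 on [cpair x k], provided that [a] halts on every [cpair x i] with
   [n <= i < k]. *)
Inductive eval (X : set nat) : code -> nat -> nat -> Prop :=
| eval_zero x : eval X Czero x 0
| eval_succ x : eval X Csucc x x.+1
| eval_fst x : eval X Cfst x (Cantor.of_nat x).1
| eval_snd x : eval X Csnd x (Cantor.of_nat x).2
| eval_query x : eval X Cquery x (nat_of_bool (x \in X))
| eval_pair a b x u v :
    eval X a x u -> eval X b x v -> eval X (Cpair a b) x (cpair u v)
| eval_comp a b x u v :
    eval X b x u -> eval X a u v -> eval X (Ccomp a b) x v
| eval_prec0 a b x v :
    eval X a x v -> eval X (Cprec a b) (cpair x 0) v
| eval_precS a b x n u v :
    eval X (Cprec a b) (cpair x n) u -> eval X b (cpair x (cpair n u)) v ->
    eval X (Cprec a b) (cpair x n.+1) v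
| eval_mu_found a x n :
    eval X a (cpair x n) 0 -> eval X (Cmu a) (cpair x n) n
| eval_mu_next a x n u v :
    eval X a (cpair x n) u.+1 -> eval X (Cmu a) (cpair x n.+1) v ->
    eval X (Cmu a) (cpair x n) v.

Definition turing_le (A X : set nat) : Prop :=
  exists c, forall x, eval X c x (nat_of_bool (x \in A)).

Fixpoint godel (c : code) : nat :=
  match c with
  | Czero => cpair 0 0
  | Csucc => cpair 1 0
  | Cfst => cpair 2 0
  | Csnd => cpair 3 0
  | Cquery => cpair 4 0
  | Cpair a b => cpair 5 (cpair (godel a) (godel b))
  | Ccomp a b => cpair 6 (cpair (godel a) (godel b))
  | Cprec a b => cpair 7 (cpair (godel a) (godel b))
  | Cmu a => cpair 8 (godel a)
  end.

(* Numbers that are not of the form [godel c] index the nowhere defined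
   program. *)
Definition jump (X : set nat) : set nat :=
  [set e | exists c v, godel c = e /\ eval X c e v].

Definition iter_jump (k : nat) (X : set nat) : set nat := iter k jump X.

Record structure := Structure {
  carrier :> Type;
  prec : carrier -> carrier -> Prop
}.

(* Isomorphism of the expansions by constants [(S, a)] and [(T, b)]. *)
Definition isomorphism (S T : structure) (a : seq S) (b : seq T)
    (f : S -> T) : Prop :=
  [/\ bijective f,
      forall x y, prec x y <-> prec (f x) (f y)
    & map f a = b].

Definition isomorphic (S T : structure) (a : seq S) (b : seq T) : Prop :=
  exists f, isomorphism a b f.

Definition substructure (S : structure) (D : set S) : structure :=
  @Structure D (fun x y => prec (val x) (val y)).

(* [order] is only meaningful on [universe]. *)
Record omega_structure := OmegaStructure {
  universe : set nat;
  order : nat -> nat -> Prop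
}.

Definition structure_of (B : omega_structure) : structure :=
  @Structure (universe B) (fun x y => order B (val x) (val y)).

Coercion structure_of : omega_structure >-> structure.

Definition computable_structure (Z : set nat) (B : omega_structure) : Prop :=
  turing_le (universe B) Z /\
  turing_le [set n | exists x y : B, n = cpair (val x) (val y) /\ prec x y] Z.

Definition graph (B C : omega_structure) (f : B -> C) : set nat :=
  [set n | exists x : B, n = cpair (val x) (val (f x))].

Section Trees.
Variable T : structure.
Implicit Types x y z r : T.

Definition is_root r : Prop := forall x, x = r \/ prec r x.

Definition imm_succ x y : Prop :=
  prec x y /\ ~ exists z, prec x z /\ prec z y.

Definition level x (k : nat) : Prop := [set y | prec y x] #= `I_k.

Definition subtree x : structure :=
  @substructure T [set y | y = x \/ prec x y].

Definition is_tree : Prop :=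
  [/\ (forall x, ~ prec x x) /\
        (forall x y z, prec x y -> prec y z -> prec x z),
      forall x, finite_set [set y | prec y x] /\
        (forall y z, prec y x -> prec z x -> [\/ prec y z, y = z | prec z y]),
      exists r, is_root r,
      countable [set: T]
    & ~ exists p : nat -> T, forall i, imm_succ (p i) (p i.+1)].

Definition is_sup (E : set nat) (s : nat) : Prop :=
  (forall i, E i -> i <= s) /\
  (forall t, (forall i, E i -> i <= t) -> s <= t).

(* Only finite ranks are needed: if the root has rank [k < omega], then all
   nodes have finite rank, and the rank is the unique [rk] as below. *)
Definition has_rank (k : nat) : Prop :=
  exists rk : T -> nat,
    (forall x, is_sup [set (rk y).+1 | y in [set y | imm_succ x y]] (rk x)) /\
    (exists2 r, is_root r & rk r = k).

End Trees.

Inductive size_omega := Fin of nat | Omega.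

Definition has_size (S : Type) (E : set S) (N : size_omega) : Prop :=
  match N with
  | Fin k => E #= `I_k
  | Omega => E #= [set: nat]
  end.

(* Types are only defined for n >= 1; the value at 0 is a dummy. *)
Fixpoint tree_type (n : nat) (N : size_omega) (T : structure) : Prop :=
  match n with
  | 0 => False
  | n'.+1 =>
    match n' with
    | 0 =>
      [/\ is_tree T,
          exists2 k, k <= 1 & has_rank T k
        & exists2 r : T, is_root r & has_size [set x | imm_succ r x] N]
    | _ =>
      [/\ is_tree T,
          has_rank T n,
          has_size
            [set x : T | level x 1 /\ tree_type n' Omega (subtree x)] N,
          forall k, has_size
            [set x : T | level x 1 /\ tree_type n' (Fin k) (subtree x)] Omega
        & forall x : T, level x 1 ->
            exists N', tree_type n' N' (subtree x)]
    end
  end.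

(* Main.v *)
From Stdlib Require Cantor.
Require Import Defs.
From mathcomp Require Import all_boot finmap.
From mathcomp Require Import boolp classical_sets functions cardinality.

Set Implicit Arguments.
Unset Strict Implicit.
Unset Printing Implicit Defensive.

Local Open Scope classical_set_scope.
Local Open Scope card_scope.

(** Constants can be pulled back along any isomorphism from a copy to [A], and an
    isomorphism that respects constants is in particular an isomorphism of trees.
    So the core is to find two [Z]-computable trees [B] and [C] of type
    [m+1 : omega] such that every isomorphism between them computes the [2m]-th
    jump of [Z].

    In the tree [B] the type of the subtree above a node of level one can be read
    off the number of the node. In the tree [C] the node of level one with number
    [cpair 0 x] spans a tree of type [m : omega] if [x] is not in the [2m]-th jump
    of [Z], and a tree of type [m : k] for some finite [k] if it is. An
    isomorphism maps nodes of level one to nodes of level one and preserves the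
    type of the subtree, and a tree has only one type ([tree_type_uniq]). Hence
    [x] is decided by searching for the node of [B] that is mapped to the node
    of [C] with number [cpair 0 x].

    Computability of [C]. Whether a node spans a tree of type [n+1 : omega]
    depends on whether infinitely many of its children span trees of type
    [n : omega], so a tree of height [m] can encode every predicate of the form
    inf b1, inf b2, ..., inf bm, Q(x, b1, ..., bm), where inf means that there are
    infinitely many and [Q] is decidable from [Z]. The complement of the [2m]-th
    jump has this form ([nested_inf_iter_jump]). That is shown one quantifier at a
    time: [inf_many_jump2] turns inf b, R with [R] decidable from [jump (jump Y)]
    into inf b, inf k, S with [S] decidable from [Y]. It rests on
    the limit lemma, used twice: once for [jump Y], to replace [b] by pairs of [b]
    and a modulus of convergence that is unique, so that no [b] is counted more
    than once; then for [Y], to turn a universal statement about [jump Y] into an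
    infinity statement about [Y] ([forall_to_inf_many]). The limit lemma in turn
    needs a computable enumeration of the jump, which comes from a universal
    machine.

    Both trees are trees of finite sequences of natural numbers, generated from a
    seed, so that a recursion on the height shows at once what their types are
    and that they are computable. They are copies of [A] because a tree type
    determines the tree up to isomorphism ([tree_type_unique]). *)

(** * Functions computable from an oracle *)

Definition p1 (x : nat) : nat := (Cantor.of_nat x).1.
Definition p2 (x : nat) : nat := (Cantor.of_nat x).2.
Arguments cpair : simpl never.
Arguments p1 : simpl never.
Arguments p2 : simpl never.

Lemma p1E x y : p1 (cpair x y) = x.
Proof. by rewrite /p1 /cpair Cantor.cancel_of_to. Qed.

Lemma p2E x y : p2 (cpair x y) = y.
Proof. by rewrite /p2 /cpair Cantor.cancel_of_to. Qed.

Lemma cpairK x : cpair (p1 x) (p2 x) = x.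
Proof.
by rewrite -[RHS]Cantor.cancel_to_of /cpair /p1 /p2; case: (Cantor.of_nat x).
Qed.

Lemma cpair_inj x y x' y' : cpair x y = cpair x' y' -> x = x' /\ y = y'.
Proof.
by move=> e; move: (congr1 p1 e) (congr1 p2 e); rewrite !p1E !p2E.
Qed.

Lemma leq_cpair x y : y <= cpair x y.
Proof.
apply: (@leq_trans (y + x)); first exact: leq_addr.
exact/leP/Cantor.to_nat_non_decreasing.
Qed.

Lemma leq_p1 x : p1 x <= x.
Proof.
rewrite -{2}[x]cpairK.
apply: (@leq_trans (p2 x + p1 x)); first exact: leq_addl.
exact/leP/Cantor.to_nat_non_decreasing.
Qed.

(** Total functions only: the partial ones are handled through [eval]. *)
Definition computable (X : set nat) (f : nat -> nat) : Prop :=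
  exists c, forall x, eval X c x (f x).

Lemma eq_computable X f g : f =1 g -> computable X f -> computable X g.
Proof. by move=> fg [c cP]; exists c => x; rewrite -fg. Qed.

Lemma computable_id X : computable X (fun z => z).
Proof.
exists (Cpair Cfst Csnd) => x; rewrite -{2}[x]cpairK.
by apply: eval_pair; constructor.
Qed.

Lemma computable_comp X f g :
  computable X f -> computable X g -> computable X (fun z => f (g z)).
Proof.
by move=> [c cP] [d dP]; exists (Ccomp c d) => x; apply: eval_comp (dP x) (cP _).
Qed.

Lemma computable_pair X f g :
  computable X f -> computable X g -> computable X (fun z => cpair (f z) (g z)).
Proof.
by move=> [c cP] [d dP]; exists (Cpair c d) => x; apply: eval_pair.
Qed.

Lemma computable_p1 X f : computable X f -> computable X (fun z => p1 (f z)).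
Proof. by apply: computable_comp; exists Cfst => x; constructor. Qed.

Lemma computable_p2 X f : computable X f -> computable X (fun z => p2 (f z)).
Proof. by apply: computable_comp; exists Csnd => x; constructor. Qed.

Lemma computable_succ X f : computable X f -> computable X (fun z => (f z).+1).
Proof. by apply: computable_comp; exists Csucc => x; constructor. Qed.

Lemma computable_const X k : computable X (fun=> k).
Proof.
by elim: k => [|k IH]; [exists Czero => x; constructor | exact: computable_succ].
Qed.

Lemma computable_mem X A f :
  turing_le A X -> computable X f ->
  computable X (fun z => nat_of_bool (f z \in A)).
Proof. exact: (@computable_comp X (fun x => nat_of_bool (x \in A))). Qed.

Lemma turing_le_refl X : turing_le X X.
Proof. by exists Cquery => x; constructor. Qed.

Lemma computable_app2 X (F : nat -> nat -> nat) f g :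
  computable X (fun w => F (p1 w) (p2 w)) -> computable X f -> computable X g ->
  computable X (fun z => F (f z) (g z)).
Proof.
move=> FX fX gX.
have := computable_comp FX (computable_pair fX gX).
by apply: eq_computable => z; rewrite p1E p2E.
Qed.

Lemma computable_rec X a (F : nat -> nat -> nat -> nat) n :
  computable X a ->
  computable X (fun w => F (p1 w) (p1 (p2 w)) (p2 (p2 w))) ->
  computable X n ->
  computable X (fun z => nat_rect (fun=> nat) (a z) (F z) (n z)).
Proof.
move=> [ca caP] [cF cFP] nX.
pose G z := nat_rect (fun=> nat) (a (p1 z)) (F (p1 z)) (p2 z).
have GX : computable X G.
  exists (Cprec ca cF) => x; rewrite -{1}[x]cpairK /G; elim: (p2 x) => [|k IH].
    exact: eval_prec0.
  refine (eval_precS IH _).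
  by have := cFP (cpair (p1 x) (cpair k
    (nat_rect (fun=> nat) (a (p1 x)) (F (p1 x)) k))); rewrite !(p1E, p2E).
have := computable_comp GX (computable_pair (computable_id X) nX).
by apply: eq_computable => z; rewrite /G p1E p2E.
Qed.

Lemma computable_iter X a (F : nat -> nat -> nat) n :
  computable X a -> computable X (fun w => F (p1 w) (p2 w)) -> computable X n ->
  computable X (fun z => iter (n z) (F z) (a z)).
Proof.
move=> aX FX nX.
have FX' : computable X (fun w => F (p1 w) (p2 (p2 w))).
  apply: (computable_app2 FX); first exact/computable_p1/computable_id.
  exact/computable_p2/computable_p2/computable_id.
have := computable_rec (F := fun z _ u => F z u) aX FX' nX.
by apply: eq_computable => z; elim: (n z) => //= k ->.
Qed.

Lemma computable_if X (b : nat -> bool) f g :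
  computable X (fun z => nat_of_bool (b z)) -> computable X f ->
  computable X g -> computable X (fun z => if b z then f z else g z).
Proof.
move=> bX fX gX.
have := computable_rec (F := fun z _ _ => f z) gX
  (computable_comp fX (computable_p1 (computable_id X))) bX.
by apply: eq_computable => z; case: (b z).
Qed.

Lemma computable_pred X f : computable X f -> computable X (fun z => (f z).-1).
Proof.
move=> fX.
have := computable_rec (F := fun _ k _ => k) (computable_const X 0)
  (computable_p1 (computable_p2 (computable_id X))) fX.
by apply: eq_computable => z; case: (f z).
Qed.

Lemma computable_eq0 X f :
  computable X f -> computable X (fun z => nat_of_bool (f z == 0)).
Proof.
move=> fX.
have := computable_rec (F := fun _ _ _ => 0) (computable_const X 1)
  (computable_const X 0) fX.
by apply: eq_computable => z; case: (f z).
Qed.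

Lemma computable_negb X (b : nat -> bool) :
  computable X (fun z => nat_of_bool (b z)) ->
  computable X (fun z => nat_of_bool (~~ b z)).
Proof.
move=> bX; have := computable_eq0 bX.
by apply: eq_computable => z; case: (b z).
Qed.

Lemma computable_andb X (a b : nat -> bool) :
  computable X (fun z => nat_of_bool (a z)) ->
  computable X (fun z => nat_of_bool (b z)) ->
  computable X (fun z => nat_of_bool (a z && b z)).
Proof.
move=> aX bX; have := computable_if aX bX (computable_const X 0).
by apply: eq_computable => z; case: (a z).
Qed.

Lemma computable_orb X (a b : nat -> bool) :
  computable X (fun z => nat_of_bool (a z)) ->
  computable X (fun z => nat_of_bool (b z)) ->
  computable X (fun z => nat_of_bool (a z || b z)).
Proof.
move=> aX bX; have := computable_if aX (computable_const X 1) bX.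
by apply: eq_computable => z; case: (a z).
Qed.

Lemma computable_leq X f g :
  computable X f -> computable X g ->
  computable X (fun z => nat_of_bool (f z <= g z)).
Proof.
move=> fX gX.
have : computable X (fun z => iter (g z) predn (f z)).
  apply: (computable_iter (F := fun _ u => u.-1)) => //.
  exact/computable_pred/computable_p2/computable_id.
move/computable_eq0; apply: eq_computable => z; rewrite -subn_eq0.
congr (nat_of_bool (_ == _)).
by elim: (g z) => [|k /= ->]; rewrite ?subn0 // subnS.
Qed.

Lemma computable_eqn X f g :
  computable X f -> computable X g ->
  computable X (fun z => nat_of_bool (f z == g z)).
Proof.
move=> fX gX.
have := computable_andb (computable_leq fX gX) (computable_leq gX fX).
by apply: eq_computable => z; rewrite eqn_leq.
Qed.

(** Proves computability by following the syntax of the function; a predicate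
    that is not built from tests on numbers is left as a goal. *)
Ltac computes := repeat lazymatch goal with
  | |- computable _ (fun z => z) => exact: computable_id
  | |- computable _ (fun _ => ?k) => exact: computable_const
  | |- computable _ p1 => exact: (computable_p1 (computable_id _))
  | |- computable _ p2 => exact: (computable_p2 (computable_id _))
  | |- computable _ (fun z => p1 (@?f z)) => apply: (@computable_p1 _ f)
  | |- computable _ (fun z => p2 (@?f z)) => apply: (@computable_p2 _ f)
  | |- computable _ (fun z => (@?f z).+1) => apply: (@computable_succ _ f)
  | |- computable _ (fun z => (@?f z).-1) => apply: (@computable_pred _ f)
  | |- computable _ (fun z => cpair (@?f z) (@?g z)) =>
      apply: (@computable_pair _ f g)
  | |- computable _ (fun z => nat_of_bool (@?f z == 0)) =>
      apply: (@computable_eq0 _ f)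
  | |- computable _ (fun z => nat_of_bool (@?f z == @?g z)) =>
      apply: (@computable_eqn _ f g)
  | |- computable _ (fun z => nat_of_bool (@?f z <= @?g z)) =>
      apply: (@computable_leq _ f g)
  | |- computable _ (fun z => nat_of_bool (~~ @?f z)) =>
      apply: (@computable_negb _ f)
  | |- computable _ (fun z => nat_of_bool (@?f z && @?g z)) =>
      apply: (@computable_andb _ f g)
  | |- computable _ (fun z => nat_of_bool (@?f z || @?g z)) =>
      apply: (@computable_orb _ f g)
  | |- computable _ (fun z => nat_of_bool _) => fail
  | |- computable _ _ => refine (computable_if _ _ _)
  end.

(** * A universal machine *)

(** The machine works on numbers: it is either about to run the program with
    Goedel number [e] on input [x], or it returns a value [v] to the stack [K].
    A stack is 0 or [push f K]. A frame [f] is a pair of a tag and of what is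
    needed to continue: 0 and 1 stand for a pair whose first, respectively
    second, component is being computed, 2 for a composition, 3 for a primitive
    recursion and 4 for a search. *)
Definition push (f K : nat) : nat := (cpair f K).+1.

Definition ret (v K : nat) : nat := cpair 0 (cpair v K).
Definition run (e x K : nat) : nat := cpair 1 (cpair (cpair e x) K).

Definition step_ret (v K : nat) : nat :=
  let f := p1 K.-1 in let K' := p2 K.-1 in let d := p2 f in
  if K == 0 then ret v K else
  if p1 f == 0 then run (p1 d) (p2 d) (push (cpair 1 v) K') else
  if p1 f == 1 then ret (cpair d v) K' else
  if p1 f == 2 then run d v K' else
  if p1 f == 3 then run (p1 d) (cpair (p1 (p2 d)) (cpair (p2 (p2 d)) v)) K' else
  if v == 0 then ret (p2 (p2 d)) K' else
  run (cpair 8 (p1 d)) (cpair (p1 (p2 d)) (p2 (p2 d)).+1) K'.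

Definition step_run (X : set nat) (e x K : nat) : nat :=
  let t := p1 e in let d := p2 e in
  if t == 0 then ret 0 K else
  if t == 1 then ret x.+1 K else
  if t == 2 then ret (p1 x) K else
  if t == 3 then ret (p2 x) K else
  if t == 4 then ret (nat_of_bool (x \in X)) K else
  if t == 5 then run (p1 d) x (push (cpair 0 (cpair (p2 d) x)) K) else
  if t == 6 then run (p2 d) x (push (cpair 2 (p1 d)) K) else
  if t == 7 then
    if p2 x == 0 then run (p1 d) (p1 x) K else
    run e (cpair (p1 x) (p2 x).-1)
      (push (cpair 3 (cpair (p2 d) (cpair (p1 x) (p2 x).-1))) K)
  else run d x (push (cpair 4 (cpair d x)) K).

Definition step (X : set nat) (s : nat) : nat :=
  let d := p2 s in
  if p1 s == 0 then step_ret (p1 d) (p2 d)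
  else step_run X (p1 (p1 d)) (p2 (p1 d)) (p2 d).

Lemma computable_step X : computable X (step X).
Proof.
rewrite /step /step_ret /step_run /run /ret /push.
computes; apply: computable_mem (turing_le_refl X) _; computes.
Qed.

Lemma step_retE X v K : step X (ret v K) = step_ret v K.
Proof. by rewrite /step /ret !(p1E, p2E). Qed.

Lemma step_runE X e x K : step X (run e x K) = step_run X e x K.
Proof. by rewrite /step /run !(p1E, p2E). Qed.

Lemma ret_inj v K v' K' : ret v K = ret v' K' -> v = v' /\ K = K'.
Proof. by move=> /cpair_inj[_] /cpair_inj. Qed.

Lemma run_neq_ret e x K v K' : run e x K <> ret v K'.
Proof. by move=> /cpair_inj[]. Qed.

Lemma iter_step_ret0 X v k : iter k (step X) (ret v 0) = ret v 0.
Proof. by elim: k => //= k ->; rewrite step_retE. Qed.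

Lemma step_run_pair X a b x K :
  step X (run (godel (Cpair a b)) x K) =
  run (godel a) x (push (cpair 0 (cpair (godel b) x)) K).
Proof. by rewrite step_runE /step_run /= !(p1E, p2E). Qed.

Lemma step_run_comp X a b x K :
  step X (run (godel (Ccomp a b)) x K) =
  run (godel b) x (push (cpair 2 (godel a)) K).
Proof. by rewrite step_runE /step_run /= !(p1E, p2E). Qed.

Lemma step_run_prec0 X a b x K :
  step X (run (godel (Cprec a b)) (cpair x 0) K) = run (godel a) x K.
Proof. by rewrite step_runE /step_run /= !(p1E, p2E). Qed.

Lemma step_run_precS X a b x n K :
  step X (run (godel (Cprec a b)) (cpair x n.+1) K) =
  run (godel (Cprec a b)) (cpair x n)
    (push (cpair 3 (cpair (godel b) (cpair x n))) K).
Proof. by rewrite step_runE /step_run /= !(p1E, p2E). Qed.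

Lemma step_run_mu X a x K :
  step X (run (godel (Cmu a)) x K) =
  run (godel a) x (push (cpair 4 (cpair (godel a) x)) K).
Proof. by rewrite step_runE /step_run /= !(p1E, p2E). Qed.

Lemma step_ret_push X v f K :
  step X (ret v (push f K)) =
  let d := p2 f in
  if p1 f == 0 then run (p1 d) (p2 d) (push (cpair 1 v) K) else
  if p1 f == 1 then ret (cpair d v) K else
  if p1 f == 2 then run d v K else
  if p1 f == 3 then run (p1 d) (cpair (p1 (p2 d)) (cpair (p2 (p2 d)) v)) K else
  if v == 0 then ret (p2 (p2 d)) K else
  run (cpair 8 (p1 d)) (cpair (p1 (p2 d)) (p2 (p2 d)).+1) K.
Proof. by rewrite step_retE /step_ret /push /= !(p1E, p2E). Qed.

Definition reaches X s s' := exists k, iter k (step X) s = s'.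

Lemma reaches_trans X s s' s'' :
  reaches X s s' -> reaches X s' s'' -> reaches X s s''.
Proof. by move=> [k <-] [l <-]; exists (l + k); rewrite iterD. Qed.

Lemma reaches_step X s s' : reaches X (step X s) s' -> reaches X s s'.
Proof. by move=> [k <-]; exists k.+1; rewrite iterSr. Qed.

Lemma reaches_refl X s : reaches X s s.
Proof. by exists 0. Qed.

(** No stack is inspected before the return, which makes the induction on
    derivations work for all stacks at once. *)
Lemma run_complete X c x v :
  eval X c x v -> forall K, reaches X (run (godel c) x K) (ret v K).
Proof.
elim=> {c x v}.
- by move=> x K; apply/reaches_step; exists 0; rewrite step_runE /step_run /godel !p1E.
- by move=> x K; apply/reaches_step; exists 0; rewrite step_runE /step_run /godel !p1E.
- by move=> x K; apply/reaches_step; exists 0; rewrite step_runE /step_run /godel !p1E.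
- by move=> x K; apply/reaches_step; exists 0; rewrite step_runE /step_run /godel !p1E.
- by move=> x K; apply/reaches_step; exists 0; rewrite step_runE /step_run /godel !p1E.
- move=> a b x u v _ IHa _ IHb K.
  apply: reaches_step; rewrite step_run_pair; apply: reaches_trans (IHa _) _.
  apply: reaches_step; rewrite step_ret_push /= !(p1E, p2E) /=.
  apply: reaches_trans (IHb _) _.
  by apply: reaches_step; rewrite step_ret_push /= !(p1E, p2E); apply: reaches_refl.
- move=> a b x u v _ IHb _ IHa K.
  apply: reaches_step; rewrite step_run_comp; apply: reaches_trans (IHb _) _.
  by apply: reaches_step; rewrite step_ret_push /= !(p1E, p2E); apply: IHa.
- move=> a b x v _ IHa K.
  by apply: reaches_step; rewrite step_run_prec0; apply: IHa.
- move=> a b x n u v _ IH _ IHb K.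
  apply: reaches_step; rewrite step_run_precS; apply: reaches_trans (IH _) _.
  by apply: reaches_step; rewrite step_ret_push /= !(p1E, p2E); apply: IHb.
- move=> a x n _ IH K.
  apply: reaches_step; rewrite step_run_mu; apply: reaches_trans (IH _) _.
  by apply: reaches_step; rewrite step_ret_push /= !(p1E, p2E); apply: reaches_refl.
- move=> a x n u v _ IHa _ IH K.
  apply: reaches_step; rewrite step_run_mu; apply: reaches_trans (IHa _) _.
  by apply: reaches_step; rewrite step_ret_push /= !(p1E, p2E); apply: IH.
Qed.

(** A halting computation passes through the return of the current program,
    because the frames below it are only consumed by a return. *)
Lemma run_sound X w s c x K :
  iter s (step X) (run (godel c) x K) = ret w 0 ->
  exists v s', [/\ s' < s, eval X c x v & iter s' (step X) (ret v K) = ret w 0].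
Proof.
elim/ltn_ind: s c x K => -[_ c x K /run_neq_ret //|s IH c x K].
rewrite iterSr.
(* a return to a frame is not a final state, so that a step remains *)
have unpush s1 v f K1 : iter s1 (step X) (ret v (push f K1)) = ret w 0 ->
    exists2 s2, s1 = s2.+1 & iter s2 (step X) (step X (ret v (push f K1))) = ret w 0.
  by case: s1 => [/ret_inj[]//|s2]; rewrite iterSr; exists s2.
case: c.
- by rewrite step_runE /step_run /godel !p1E; exists 0, s; split=> //; constructor.
- by rewrite step_runE /step_run /godel !p1E; exists x.+1, s; split=> //; constructor.
- by rewrite step_runE /step_run /godel !p1E; exists (p1 x), s; split=> //; constructor.
- by rewrite step_runE /step_run /godel !p1E; exists (p2 x), s; split=> //; constructor.
- rewrite step_runE /step_run /godel !p1E /=.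
  by exists (nat_of_bool (x \in X)), s; split=> //; constructor.
- move=> a b; rewrite step_run_pair => /(IH _ (ltnSn s))[u [s1 [s1s evu]]].
  case/unpush=> s2 e; rewrite step_ret_push /= !(p1E, p2E) /=.
  have s2s : s2 < s by rewrite -ltnS -e ltnS ltnW.
  case/IH=> [|v [s3 [s3s2 evv]]]; first exact: ltnW.
  case/unpush=> s4 e'; rewrite step_ret_push /= !(p1E, p2E) /= => h.
  exists (cpair u v), s4; split=> //; last exact: eval_pair.
  by rewrite ltnW // ltnS -e' ltnW // (ltn_trans s3s2).
- move=> a b; rewrite step_run_comp => /(IH _ (ltnSn s))[u [s1 [s1s evu]]].
  case/unpush=> s2 e; rewrite step_ret_push /= !(p1E, p2E) /=.
  have s2s : s2 < s by rewrite -ltnS -e ltnS ltnW.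
  case/IH=> [|v [s3 [s3s2 evv]]]; first exact: ltnW.
  exists v, s3; split=> //; last exact: eval_comp evu evv.
  by rewrite ltnW // ltnS (ltn_trans s3s2).
- move=> a b; rewrite -[x]cpairK; case: (p2 x) => [|n].
    rewrite step_run_prec0 => /(IH _ (ltnSn s))[v [s1 [s1s ev h]]].
    by exists v, s1; split=> //; [rewrite ltnW | exact: eval_prec0].
  rewrite step_run_precS => /(IH _ (ltnSn s))[u [s1 [s1s evu]]].
  case/unpush=> s2 e; rewrite step_ret_push /= !(p1E, p2E) /=.
  have s2s : s2 < s by rewrite -ltnS -e ltnS ltnW.
  case/IH=> [|v [s3 [s3s2 evv]]]; first exact: ltnW.
  exists v, s3; split=> //; last exact: eval_precS evu evv.
  by rewrite ltnW // ltnS (ltn_trans s3s2).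
- move=> a; rewrite -[x]cpairK step_run_mu.
  move=> /(IH _ (ltnSn s))[u [s1 [s1s evu]]].
  case/unpush=> s2 e; rewrite step_ret_push /= !(p1E, p2E) /=.
  have s2s : s2 < s by rewrite -ltnS -e ltnS ltnW.
  case: u evu => [|u] evu /=.
    by exists (p2 x), s2; split=> //; [rewrite ltnW | exact: eval_mu_found].
  case/(IH _ (ltnW s2s) (Cmu a))=> v [s3 [s3s2 evv]].
  exists v, s3; split=> //; last exact: eval_mu_next evu evv.
  by rewrite ltnW // ltnS (ltn_trans s3s2).
Qed.

(** * Recognising the Goedel numbers *)

(** The machine may halt on a number that is not a Goedel number, because it
    only looks at the subprograms that it runs; such numbers are not in the jump
    and have to be excluded separately.

    The state is a stack of numbers that remain to be checked; a number that is
    seen not to be a Goedel number blocks the stack for ever. *)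
Definition check (s : nat) : nat :=
  let e := p1 s.-1 in let K := p2 s.-1 in let t := p1 e in let d := p2 e in
  if s == 0 then 0 else
  if t <= 4 then (if d == 0 then K else s) else
  if t <= 7 then push (p1 d) (push (p2 d) K) else
  if t == 8 then push d K else s.

Lemma computable_check X : computable X check.
Proof. by rewrite /check /push; computes. Qed.

Lemma check_push e K :
  check (push e K) =
  if p1 e <= 4 then (if p2 e == 0 then K else push e K) else
  if p1 e <= 7 then push (p1 (p2 e)) (push (p2 (p2 e)) K) else
  if p1 e == 8 then push (p2 e) K else push e K.
Proof. by rewrite /check /push /= p1E p2E. Qed.

Lemma iter_check0 k : iter k check 0 = 0.
Proof. by elim: k => //= k ->. Qed.

Lemma check_complete c K : exists k, iter k check (push (godel c) K) = K.
Proof.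
have two a b t K1 : t \in [:: 5; 6; 7] ->
    (forall K, exists k, iter k check (push (godel a) K) = K) ->
    (forall K, exists k, iter k check (push (godel b) K) = K) ->
    exists k, iter k check (push (cpair t (cpair (godel a) (godel b))) K1) = K1.
  move=> ht IHa IHb.
  have [k ka] := IHa (push (godel b) K1); have [l lb] := IHb K1.
  exists (l + k).+1; rewrite iterSr check_push !(p1E, p2E).
  have [-> ->] : (t <= 4) = false /\ t <= 7.
    by move: ht; rewrite !inE => /or3P[]/eqP->.
  by rewrite iterD ka lb.
elim: c K => [||||| a IHa b IHb | a IHa b IHb | a IHa b IHb | a IHa] K;
  try by exists 1; rewrite /godel /iter check_push !(p1E, p2E).
- exact: two.
- exact: two.
- exact: two.
have [k ka] := IHa K.
by exists k.+1; rewrite iterSr check_push /= !(p1E, p2E).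
Qed.

(** Emptying the stack consumes its elements one after the other, so that each
    of them passes the test. *)
Lemma check_sound k e K : iter k check (push e K) = 0 ->
  (exists c, godel c = e) /\ exists2 l, l <= k & iter l check K = 0.
Proof.
elim/ltn_ind: k e K => -[//|k IH] e K; rewrite iterSr check_push.
move: (cpairK e); move: (p1 e) (p2 e) => t d <-; case: leqP => [t4|t5].
  case: eqP => [->|_] h; last first.
    have [ge [l lk lK]] := IH _ (ltnSn k) _ _ h.
    by split=> //; exists l; rewrite // ltnW.
  split; last by exists k.
  case: t t4 => [|[|[|[|[|//]]]]] _.
  - by exists Czero.
  - by exists Csucc.
  - by exists Cfst.
  - by exists Csnd.
  - by exists Cquery.
case: leqP => [t7|t8] h.
  have [[a aE] [l lk h1]] := IH _ (ltnSn k) _ _ h.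
  have [[b bE] [l' ll' h2]] := IH _ (leq_ltn_trans lk (ltnSn k)) _ _ h1.
  split; last by exists l'; rewrite // ltnW // ltnS (leq_trans ll').
  rewrite -[d]cpairK -aE -bE.
  case: t t5 t7 => [|[|[|[|[|[|[|[|//]]]]]]]] // _ _.
  - by exists (Cpair a b).
  - by exists (Ccomp a b).
  - by exists (Cprec a b).
move: h; case: eqP => [->|_] h.
  have [[a aE] [l lk lK]] := IH _ (ltnSn k) _ _ h.
  by split; [exists (Cmu a); rewrite -aE | exists l; rewrite // ltnW].
have [ge [l lk lK]] := IH _ (ltnSn k) _ _ h.
by split=> //; exists l; rewrite // ltnW.
Qed.

(** * Limit approximations *)

(** The enumeration of [jump X]: [e] is a Goedel number and the run of [e] on
    [e] ends with an empty stack, both within [s] steps. *)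
Definition jump_at (X : set nat) (e s : nat) : bool :=
  [&& iter s check (push e 0) == 0, p1 (iter s (step X) (run e e 0)) == 0
    & p2 (p2 (iter s (step X) (run e e 0))) == 0].

Lemma computable_jump_at X e s : computable X e -> computable X s ->
  computable X (fun z => nat_of_bool (jump_at X (e z) (s z))).
Proof.
move=> eX sX.
have cX : computable X (fun z => iter (s z) check (push (e z) 0)).
  apply: (computable_iter (F := fun=> check)) => //.
    by rewrite /push; computes.
  exact: (computable_comp (computable_check X) (computable_p2 (computable_id X))).
have rX : computable X (fun z => iter (s z) (step X) (run (e z) (e z) 0)).
  apply: (computable_iter (F := fun=> step X)) => //.
    by rewrite /run; computes.
  exact: (computable_comp (computable_step X) (computable_p2 (computable_id X))).
by rewrite /jump_at; computes.
Qed.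

Lemma jump_at_mono X e s t : s <= t -> jump_at X e s -> jump_at X e t.
Proof.
move=> /subnK<-; rewrite /jump_at !iterD => /and3P[/eqP-> r0 K0].
have -> : iter s (step X) (run e e 0) =
    ret (p1 (p2 (iter s (step X) (run e e 0)))) 0.
  by rewrite -[LHS]cpairK -[p2 (iter _ _ _) in LHS]cpairK (eqP r0) (eqP K0).
by rewrite iter_check0 iter_step_ret0 /ret !(p1E, p2E).
Qed.

Lemma jumpP X e : jump X e <-> exists s, jump_at X e s.
Proof.
split=> [[c [v [<- ev]]]|[s /and3P[/eqP ck r0 K0]]].
  have [k kP] := check_complete c 0; have [l lP] := run_complete ev 0.
  exists (l + k); apply/and3P.
  by rewrite iterD kP iter_check0 addnC iterD lP iter_step_ret0 /ret !(p1E, p2E).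
have [[c ce] _] := check_sound ck; exists c.
have h : iter s (step X) (run (godel c) e 0) =
    ret (p1 (p2 (iter s (step X) (run e e 0)))) 0.
  rewrite ce -[LHS]cpairK -[p2 (iter _ _ _) in LHS]cpairK.
  by rewrite (eqP r0) (eqP K0).
by have [v [s' [_ ev _]]] := run_sound h; exists v.
Qed.

Lemma jump_at_lim X e : exists t0, forall t, t0 <= t -> jump_at X e t = (e \in jump X).
Proof.
have [ein|eout] := pselect (jump X e).
  have [s es] := (jumpP X e).1 ein.
  by exists s => t st; rewrite (jump_at_mono st es); apply/esym/mem_set.
exists 0 => t _; rewrite (memNset eout); apply/negP => et.
by apply: eout; apply/jumpP; exists t.
Qed.

(** What the program [c] computes at stage [t], when its oracle is replaced by
    the guess [g] at that oracle; the search made by [Cmu] is cut off after [t]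
    rounds, so that the value is always defined. *)
Fixpoint approx (g : nat -> nat -> bool) (c : code) (x t : nat) : nat :=
  match c with
  | Czero => 0
  | Csucc => x.+1
  | Cfst => p1 x
  | Csnd => p2 x
  | Cquery => g x t
  | Cpair a b => cpair (approx g a x t) (approx g b x t)
  | Ccomp a b => approx g a (approx g b x t) t
  | Cprec a b =>
      nat_rect (fun=> nat) (approx g a (p1 x) t)
        (fun n u => approx g b (cpair (p1 x) (cpair n u)) t) (p2 x)
  | Cmu a =>
      iter t (fun n => if approx g a (cpair (p1 x) n) t == 0 then n else n.+1)
        (p2 x)
  end.

Lemma computable_approx Y g c :
  computable Y (fun w => nat_of_bool (g (p1 w) (p2 w))) ->
  computable Y (fun w => approx g c (p1 w) (p2 w)).
Proof.
move=> gY; elim: c => /=; try by computes.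
- by move=> a aY b bY; computes.
- by move=> a aY b bY; apply: (computable_app2 aY) => //; computes.
- move=> a aY b bY.
  apply: (computable_rec
    (F := fun w n u => approx g b (cpair (p1 (p1 w)) (cpair n u)) (p2 w)));
    try by computes.
  + by apply: (computable_app2 aY); computes.
  + by apply: (computable_app2 bY); computes.
- move=> a aY.
  apply: (computable_iter (F := fun w n =>
    if approx g a (cpair (p1 (p1 w)) n) (p2 w) == 0 then n else n.+1));
    try by computes.
  by computes; apply: (computable_app2 aY); computes.
Qed.

Definition converges (f : nat -> nat) (v : nat) : Prop :=
  exists t0, forall t, t0 <= t -> f t = v.

Lemma eval_pairP X a b x w : eval X (Cpair a b) x w ->
  exists u v, [/\ eval X a x u, eval X b x v & w = cpair u v].
Proof. by move=> ev; inversion ev; do 2 eexists; split; eauto. Qed.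

Lemma eval_compP X a b x v : eval X (Ccomp a b) x v ->
  exists2 u, eval X b x u & eval X a u v.
Proof. by move=> ev; inversion ev; eexists; eassumption. Qed.

Lemma eval_muP X a z v : eval X (Cmu a) z v ->
  [/\ p2 z <= v, eval X a (cpair (p1 z) v) 0
    & forall i, p2 z <= i < v -> exists u, eval X a (cpair (p1 z) i) u.+1].
Proof.
move ec : (Cmu a) => c ev; elim: ev ec => // {c z v}.
  move=> b x n ev _ [->]; rewrite !(p1E, p2E); split=> // i.
  by case: ltngtP.
move=> b x n u v evu _ _ IH [ab]; subst b.
case: (IH erefl); rewrite !(p1E, p2E) => nv ev IH'; split=> //; first exact: ltnW.
move=> i /andP[]; rewrite leq_eqVlt => /predU1P[<- _|ni iv]; first by exists u.
by apply: IH'; rewrite ni.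
Qed.

(** A terminating computation uses finitely many values of the oracle, and the
    guesses at all of them are correct from some stage on. *)
Lemma approx_lim g X c x v :
  (forall x, exists t0, forall t, t0 <= t -> g x t = (x \in X)) ->
  eval X c x v -> converges (approx g c x) v.
Proof.
move=> gX; elim: c x v => [||||| a IHa b IHb | a IHa b IHb | a IHa b IHb | a IHa] x v ev.
- by inversion ev; exists 0.
- by inversion ev; exists 0.
- by inversion ev; exists 0.
- by inversion ev; exists 0.
- inversion ev; subst; have [t0 t0P] := gX x.
  by exists t0 => t tt; rewrite /= t0P.
- have [u [w [evu evw ->]]] := eval_pairP ev.
  have [s sP] := IHa _ _ evu; have [t tP] := IHb _ _ evw.
  by exists (maxn s t) => k; rewrite geq_max => /andP[sk tk] /=; rewrite sP // tP.
- have [u evu evv] := eval_compP ev.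
  have [s sP] := IHb _ _ evu; have [t tP] := IHa _ _ evv.
  by exists (maxn s t) => k; rewrite geq_max => /andP[sk tk] /=; rewrite sP // tP.
- move: ev; move ec : (Cprec a b) => c ev; elim: ev ec => // {c x v}.
    move=> a' b' x v ev _ [? ?]; subst a' b'.
    have [s sP] := IHa _ _ ev.
    by exists s => t st; rewrite /= p2E /= p1E sP.
  move=> a' b' x n u v _ IH ev _ [? ?]; subst a' b'.
  have [s sP] := IH erefl; have [t tP] := IHb _ _ ev.
  exists (maxn s t) => k; rewrite geq_max => /andP[sk tk].
  by have := sP _ sk; rewrite /= !(p1E, p2E) /= => ->; rewrite tP.
have [nv ev0 evS] := eval_muP ev.
have [s sP] := IHa _ _ ev0.
(* a stage from which on all values below [v] are seen to be non-zero *)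
have [t tP] : exists t0, forall t i, t0 <= t -> p2 x <= i < v ->
    approx g a (cpair (p1 x) i) t != 0.
  elim: (v) evS => [|w IHw] evS; first by exists 0 => t i _; rewrite ltn0 andbF.
  case: IHw => [i /andP[xi iw]|t1 t1P]; first by apply: evS; rewrite xi ltnW.
  have [xw|wx] := leqP (p2 x) w; last first.
    exists t1 => t i tt /andP[xi iw].
    by have := leq_trans xi iw; rewrite leqNgt wx.
  have [|u /IHa[t2 t2P]] := evS w; first by rewrite xw ltnSn.
  exists (maxn t1 t2) => k i; rewrite geq_max => /andP[k1 k2] /andP[xi].
  rewrite ltnS leq_eqVlt => /predU1P[->|iw]; first by rewrite t2P.
  by apply: t1P; rewrite // xi.
exists (maxn v (maxn s t)) => k; rewrite !geq_max => /and3P[vk sk tk] /=.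
suff -> j : iter j (fun n => if approx g a (cpair (p1 x) n) k == 0 then n else n.+1)
    (p2 x) = minn (p2 x + j) v.
  by apply/minn_idPr; rewrite (leq_trans vk) // leq_addl.
elim: j => [|j IHj]; first by rewrite addn0 /=; apply/esym/minn_idPl.
rewrite iterS IHj; have [xjv|vxj] := ltnP (p2 x + j) v.
  rewrite (negPf (tP _ _ tk _)); last by rewrite leq_addr.
  by rewrite addnS; apply/esym/minn_idPl.
by rewrite sP //= addnS; apply/esym/minn_idPr; rewrite (leq_trans vxj).
Qed.

(** Shoenfield's limit lemma, from jumps to limits. *)
Lemma limit_lemma Y f : computable (jump Y) f ->
  exists2 F : nat -> nat -> nat, computable Y (fun w => F (p1 w) (p2 w))
    & forall x, converges (F x) (f x).
Proof.
move=> [c cP]; exists (approx (jump_at Y) c).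
  by apply/computable_approx/computable_jump_at; computes.
by move=> x; apply: approx_lim (cP x) => y; apply: jump_at_lim.
Qed.

(** * Iterated jumps and nested infinity quantifiers *)

(** Unboundedness, which is easier to use than infinity as a cardinality; see
    [inf_manyP] for the latter. *)
Definition inf_many (P : nat -> Prop) : Prop := forall N, exists2 n, N <= n & P n.

Lemma eq_inf_many P Q : (forall n, P n <-> Q n) -> inf_many P <-> inf_many Q.
Proof.
by move=> PQ; split=> h N; have [n Nn /PQ Pn] := h N; exists n.
Qed.

Lemma turing_le_bool X (b : nat -> bool) :
  computable X (fun x => nat_of_bool (b x)) -> turing_le [set x | b x] X.
Proof.
by apply: eq_computable => x; congr nat_of_bool; apply/idP/idP; rewrite inE.
Qed.

(** A counter that increases by at most one skips no value. *)
Lemma counter_hits (q : nat -> nat) v T : q 0 = 0 ->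
  (forall t, q t.+1 <= (q t).+1) -> v <= q T -> exists t, q t = v.
Proof.
move=> q0 qS; elim: T => [|T IH].
  by rewrite q0 leqn0 => /eqP->; exists 0.
move=> vT; have [/IH//|Tv] := leqP v (q T).
by exists T.+1; apply/eqP; rewrite eqn_leq vT (leq_trans (qS T)).
Qed.

(** A counter [q] is increased at stage [t] when the guess of stage [t] about
    [R (cpair z (p1 q))] is positive. As [p1] takes every value infinitely
    often, the counter gets stuck at a single failure of [R], whereas it never
    stops if there is no failure. *)
Lemma forall_to_inf_many Y R : turing_le R (jump Y) ->
  exists2 S, turing_le S Y &
    forall z, (forall s, R (cpair z s)) <-> inf_many (fun k => S (cpair z k)).
Proof.
move=> /limit_lemma[F FY FR].
pose q z t := nat_rect (fun=> nat) 0
  (fun t q => if F (cpair z (p1 q)) t == 1 then q.+1 else q) t.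
pose up z t := F (cpair z (p1 (q z t))) t == 1.
have qY : computable Y (fun w => q (p1 w) (p2 w)).
  apply: (computable_rec (F := fun w t q =>
    if F (cpair (p1 w) (p1 q)) t == 1 then q.+1 else q)); computes.
  by apply: (computable_app2 FY); computes.
exists [set w | up (p1 w) (p2 w)].
  apply: turing_le_bool; rewrite /up; computes.
  by apply: (computable_app2 FY); computes; assumption.
move=> z; have qS t : q z t.+1 = if up z t then (q z t).+1 else q z t by [].
have qmono s t : s <= t -> q z s <= q z t.
  move=> /subnK<-; elim: (t - s) => // k; rewrite addSn qS => /leq_trans; apply.
  by case: ifP.
have qle t : q z t <= t.
  elim: t => // t; rewrite qS; case: ifP => // _; exact: leqW.
have toup : inf_many (fun k => [set w | up (p1 w) (p2 w)] (cpair z k)) <->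
    inf_many (up z).
  by apply: eq_inf_many => k /=; rewrite p1E p2E.
split=> [Rz|/toup upz s].
  apply/toup => N; apply: contrapT => noup.
  have qN k : q z (N + k) = q z N.
    elim: k => [|k IH]; rewrite ?addn0 // addnS qS; case: ifP => // u.
    by case: noup; exists (N + k); rewrite // leq_addr.
  have [t tP] := FR (cpair z (p1 (q z N))).
  apply: noup; exists (N + t); first exact: leq_addr.
  rewrite /up qN tP ?leq_addl //.
  by have := Rz (p1 (q z N)) => /mem_set->.
apply: contrapT => nR.
have [t0 t0P] := FR (cpair z s).
have unbounded v : exists T, v <= q z T.
  elim: v => [|v [T vT]]; first by exists 0.
  have [t Tt upt] := upz T; exists t.+1; rewrite qS upt ltnS.
  exact: leq_trans vT (qmono _ _ Tt).
have [T /(counter_hits (q := q z)) []] := unbounded (cpair s t0) => //.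
  by move=> t; rewrite qS; case: ifP.
move=> t qt.
have t0t : t0 <= t by rewrite (leq_trans (leq_cpair s t0)) // -qt.
have stuck k : up z (t + k) = false /\ q z (t + k) = cpair s t0.
  have noup k' : q z (t + k') = cpair s t0 -> up z (t + k') = false.
    move=> e; rewrite /up e p1E t0P ?(leq_trans t0t) ?leq_addr //.
    by rewrite memNset.
  elim: k => [|k [u e]]; first by split; rewrite ?noup // addn0.
  have e' : q z (t + k.+1) = cpair s t0 by rewrite addnS qS u.
  by split=> //; apply: noup.
have [k tk] := upz t.
by rewrite -(subnKC tk) (stuck _).1.
Qed.

(** The projection [p1] is a bijection from [T] to [P]; it does not increase
    numbers, so that unboundedness goes from [P] to [T], and only finitely many
    elements of [T] lie above an initial segment. *)
Lemma inf_many_unique (P T : nat -> Prop) :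
  (forall b, T b -> P (p1 b)) ->
  (forall b b', T b -> T b' -> p1 b = p1 b' -> b = b') ->
  (forall n, P n -> exists2 b, p1 b = n & T b) ->
  inf_many P <-> inf_many T.
Proof.
move=> TP Tuniq PT; split=> [Pinf N|Tinf N].
  have [n Nn /PT[b bn Tb]] := Pinf N.
  by exists b => //; rewrite (leq_trans Nn) // -bn leq_p1.
suff [M MP] : exists M, forall b, T b -> p1 b < N -> b < M.
  have [b Mb Tb] := Tinf M; exists (p1 b); last exact: TP.
  by rewrite leqNgt; apply/negP => /(MP _ Tb); rewrite ltnNge Mb.
elim: N => [|N [M MP]]; first by exists 0.
have [[b0 [Tb0 b0N]]|no] := pselect (exists b, T b /\ p1 b = N).
  exists (maxn M b0.+1) => b Tb; rewrite leq_max ltnS leq_eqVlt.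
  move=> /predU1P[bN|/(MP _ Tb)->//].
  by rewrite (Tuniq b b0) ?ltnSn ?orbT // bN.
exists M => b Tb; rewrite ltnS leq_eqVlt => /predU1P[bN|]; last exact: MP.
by case: no; exists b.
Qed.

(** A number [cpair b w] with the least modulus of convergence [w] of the
    approximation to [R (cpair x b)] takes the place of [b]: that [w] is the
    least modulus is of the form [forall s], computably in [jump Y]. *)
Lemma inf_many_jump2 Y R : turing_le R (jump (jump Y)) ->
  exists2 S, turing_le S Y &
    forall x, inf_many (fun b => R (cpair x b)) <->
      inf_many (fun b => inf_many (fun k => S (cpair (cpair x b) k))).
Proof.
move=> /limit_lemma[F FY FR].
pose T x b s := ((p2 b <= s) ==> (F (cpair x (p1 b)) s == 1)) &&
  ((p2 b == 0) || (F (cpair x (p1 b)) (p2 b).-1 != 1)).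
have : turing_le [set y | T (p1 (p1 y)) (p2 (p1 y)) (p2 y)] (jump Y).
  apply: turing_le_bool.
  apply: (@eq_computable _ (fun y => nat_of_bool
    ((~~ (p2 (p2 (p1 y)) <= p2 y) ||
      (F (cpair (p1 (p1 y)) (p1 (p2 (p1 y)))) (p2 y) == 1)) &&
    ((p2 (p2 (p1 y)) == 0) ||
     ~~ (F (cpair (p1 (p1 y)) (p1 (p2 (p1 y)))) (p2 (p2 (p1 y))).-1 == 1))))).
    by move=> y; rewrite /T implybE.
  by computes; apply: (computable_app2 FY); computes.
case/forall_to_inf_many => S SY SP; exists S => // x.
refine (iff_trans _ (eq_inf_many (fun b => SP (cpair x b)))).
have TE b s : [set y | T (p1 (p1 y)) (p2 (p1 y)) (p2 y)] (cpair (cpair x b) s)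
    <-> T x b s by rewrite /= !(p1E, p2E).
apply: inf_many_unique.
- move=> b Tb; have [t tP] := FR (cpair x (p1 b)).
  have /TE/andP[/implyP h _] := Tb (maxn t (p2 b)).
  move/eqP: (h (leq_maxr _ _)); rewrite tP ?leq_maxl //.
  by case: (boolP (_ \in R)) => // /set_mem.
- have least b b' : p1 b = p1 b' -> (forall s, T x b s) -> (forall s, T x b' s) ->
      p2 b <= p2 b'.
    move=> bb' Tb Tb'; rewrite leqNgt; apply/negP => lt.
    have /andP[_ /orP[/eqP b0|/negP]] := Tb 0; first by rewrite b0 in lt.
    apply; have /andP[/implyP h _] := Tb' (p2 b).-1.
    by rewrite bb'; apply: h; rewrite -ltnS prednK // (leq_ltn_trans _ lt).
  move=> b b' Tb Tb' bb'; rewrite -[b]cpairK -[b']cpairK bb'; congr cpair.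
  by apply/eqP; rewrite eqn_leq; apply/andP; split; apply: least => // s; apply/TE.
move=> n Rn.
have lim : exists w, `[< forall s, w <= s -> F (cpair x n) s = 1 >].
  have [t tP] := FR (cpair x n); exists t; apply/asboolP => s ts.
  by rewrite tP // mem_set.
case: (ex_minnP lim) => w /asboolP wP wmin.
exists (cpair n w); rewrite ?p1E // => s; apply/TE/andP; rewrite p1E p2E; split.
  by apply/implyP => /wP->.
case: w wP wmin => //= w wP wmin; apply/eqP => Fw.
have : w.+1 <= w; last by rewrite ltnn.
apply: wmin; apply/asboolP => t; rewrite leq_eqVlt => /predU1P[<-//|]; exact: wP.
Qed.

(** The variables bound by the quantifiers are paired to [x] one after the
    other. *)
Fixpoint nested_inf (n : nat) (Q : nat -> Prop) (x : nat) : Prop :=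
  if n is n'.+1 then inf_many (fun b => nested_inf n' Q (cpair x b)) else Q x.

Lemma iter_jumpS2 n Z : iter_jump (2 * n.+1) Z = jump (jump (iter_jump (2 * n) Z)).
Proof. by rewrite mulnS. Qed.

(** Every step removes two jumps and adds one quantifier inside those that are
    already present. *)
Lemma inf_many_iter_jump Z n R : turing_le R (iter_jump (2 * n) Z) ->
  exists2 Q, turing_le Q Z &
    forall x, inf_many (fun b => R (cpair x b)) <-> nested_inf n.+1 Q x.
Proof.
elim: n R => [|n IH] R; first by exists R.
rewrite iter_jumpS2 => /inf_many_jump2[S /IH[Q QZ QP] SP].
exists Q => // x; apply: iff_trans (SP x) _.
by apply: eq_inf_many => b; apply: QP.
Qed.

(** Not being in the jump of [jump X] is a universal statement about the stages
    of the enumeration, decidable from [jump X]; this yields the first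
    quantifier. *)
Lemma nested_inf_iter_jump Z n :
  exists2 Q, turing_le Q Z &
    forall x, ~ iter_jump (2 * n.+1) Z x <-> nested_inf n.+1 Q (cpair 0 x).
Proof.
rewrite iter_jumpS2; set X := iter_jump _ _.
have : turing_le [set y | ~~ jump_at (jump X) (p2 (p1 y)) (p2 y)] (jump X).
  by apply: turing_le_bool; computes; apply: computable_jump_at; computes.
case/forall_to_inf_many => S /inf_many_iter_jump[Q QZ QP] SP.
exists Q => // x; rewrite -QP -SP; split.
  move=> nx s /=; rewrite !(p1E, p2E); apply/negP => h.
  by apply: nx; apply/jumpP; exists s.
by move=> h /jumpP[s js]; have := h s; rewrite /= !(p1E, p2E) js.
Qed.

(** * Isomorphism invariance of tree types *)

Definition is_iso (S T : structure) (f : S -> T) (g : T -> S) : Prop :=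
  [/\ cancel f g, cancel g f & forall x y, prec x y <-> prec (f x) (f y)].

Definition isom (S T : structure) : Prop := exists f g, @is_iso S T f g.

Lemma is_iso_sym (S T : structure) (f : S -> T) (g : T -> S) :
  is_iso f g -> is_iso g f.
Proof. by case=> fK gK fP; split=> // x y; rewrite fP !gK. Qed.

Lemma isom_sym (S T : structure) : isom S T -> isom T S.
Proof. by case=> f [g /is_iso_sym fg]; exists g, f. Qed.

Lemma isomorphism_is_iso (S T : structure) (a : seq S) (b : seq T) (f : S -> T) :
  isomorphism a b f -> exists g, is_iso f g.
Proof. by case=> -[g fK gK] fP _; exists g. Qed.

Lemma isom_isomorphic (S T : structure) (b : seq T) :
  isom S T -> exists a : seq S, isomorphic a b.
Proof.
case=> f [g [fK gK fP]]; exists (map g b), f; split=> //; first by exists g.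
by rewrite -map_comp (eq_map gK) map_id.
Qed.

Lemma card_bij_on (S T : Type) (f : S -> T) (g : T -> S) (E : set S) (E' : set T) :
  cancel f g -> cancel g f -> (forall x, E x <-> E' (f x)) -> E #= E'.
Proof.
move=> fK gK EE; have -> : E' = f @` E.
  apply/seteqP; split=> [y|_ [x Ex <-]]; last exact/EE.
  by exists (g y); rewrite ?gK //; apply/EE; rewrite gK.
by apply: card_esym; apply: inj_card_eq => x y _ _; apply: can_inj.
Qed.

Lemma has_size_card (S T : Type) (E : set S) (E' : set T) N :
  E #= E' -> has_size E N -> has_size E' N.
Proof.
move=> /card_esym EE.
by case: N => [k|] /= h; apply: card_eq_trans EE h.
Qed.

Lemma has_size_uniq (S : Type) (E : set S) N N' :
  has_size E N -> has_size E N' -> N = N'.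
Proof.
case: N => [k|]; case: N' => [k'|] //= /card_esym h h'.
- by have /card_eq_II-> := card_eq_trans h h'.
- case: infinite_nat; exists k.
  by apply: card_esym; apply: card_eq_trans h h'.
- by case: infinite_nat; exists k'; apply: card_eq_trans h h'.
Qed.

Lemma has_size_card_eq (S T : Type) (E : set S) (E' : set T) N :
  has_size E N -> has_size E' N -> E #= E'.
Proof.
by case: N => [k|] /= h /card_esym h'; apply: card_eq_trans h h'.
Qed.

Lemma has_size_exists (E : set nat) : exists N, has_size E N.
Proof.
have [[k Ek]|/infiniteP Einf] := pselect (finite_set E); first by exists (Fin k).
exists Omega; rewrite /= card_eq_le Einf andbT.
exact: countableP.
Qed.

Section Transfer.
Variables (S T : structure) (f : S -> T) (g : T -> S).
Hypothesis fg : is_iso f g.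

Let fK : cancel f g. Proof. by case: fg. Qed.
Let gK : cancel g f. Proof. by case: fg. Qed.
Let fP x y : prec x y <-> prec (f x) (f y). Proof. by case: fg. Qed.

Lemma iso_root r : is_root r <-> is_root (f r).
Proof.
split=> h x.
  case: (h (g x)) => [<-|/fP]; first by rewrite gK; left.
  by rewrite gK; right.
by case: (h (f x)) => [/(can_inj fK)|/fP]; [left|right].
Qed.

Lemma iso_imm_succ x y : imm_succ x y <-> imm_succ (f x) (f y).
Proof.
split=> -[xy nz]; split; try exact/fP; case=> z [xz zy]; apply: nz.
  by exists (g z); split; apply/fP; rewrite gK.
by exists (f z); split; apply/fP.
Qed.

Lemma iso_level x k : level x k <-> level (f x) k.
Proof.
have e : [set y | prec y x] #= [set y | prec y (f x)].
  by apply: (card_bij_on fK gK) => y /=.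
rewrite /level; split=> h; last exact: card_eq_trans e h.
by apply: card_eq_trans h; apply: card_esym.
Qed.

Lemma iso_is_tree : is_tree S -> is_tree T.
Proof.
have gP x y : prec x y <-> prec (g x) (g y) by rewrite fP !gK.
move=> [[irr tr] fin [r rr] cnt nopath]; split.
- split=> [x /gP/irr//|x y z /gP xy /gP yz]; apply/gP; exact: tr xy yz.
- move=> x; have [finx linx] := fin (g x); split.
    suff -> : [set y | prec y x] = f @` [set y | prec y (g x)].
      exact: finite_image.
    apply/seteqP; split=> [y /gP yx|_ [y yx <-]]; last by apply/gP; rewrite fK.
    by exists (g y); rewrite ?gK.
  move=> y z /gP yx /gP zx; case: (linx _ _ yx zx) => [/gP|/(can_inj gK)|/gP] h.
  + exact: Or31.
  + exact: Or32.
  + exact: Or33.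
- by exists (f r); apply/iso_root.
- have e : [set: S] #= [set: T] by apply: (card_bij_on fK gK).
  by rewrite -(eq_countable e).
case=> p pP; apply: nopath; exists (g \o p) => i /=.
by apply/iso_imm_succ; rewrite !gK.
Qed.

Lemma iso_has_rank k : has_rank S k -> has_rank T k.
Proof.
move=> [rk [rkP [r rr rrk]]]; exists (rk \o g); split=> /= [x|].
  suff -> : [set (rk (g y)).+1 | y in [set y | imm_succ x y]] =
      [set (rk y).+1 | y in [set y | imm_succ (g x) y]] by [].
  apply/seteqP; split=> _ [y /= xy <-].
    by exists (g y) => //=; apply/iso_imm_succ; rewrite !gK.
  by exists (f y) => /=; rewrite ?fK //; move/iso_imm_succ: xy; rewrite gK.
by exists (f r); rewrite ?fK //; apply/iso_root.
Qed.

Lemma iso_subtree x : isom (subtree x) (subtree (f x)).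
Proof.
have h y : (y = x \/ prec x y) <-> (f y = f x \/ prec (f x) (f y)).
  by rewrite fP; split=> -[e|]; [left; rewrite e|right|left; exact: (can_inj fK)|right].
have mf (y : subtree x) : f (val y) \in [set z | z = f x \/ prec (f x) z].
  by apply/mem_set/h; have := set_valP y.
have mg (y : subtree (f x)) : g (val y) \in [set z | z = x \/ prec x z].
  by apply/mem_set/h; rewrite gK; have := set_valP y.
exists (fun y => SigSub (mf y)), (fun y => SigSub (mg y)); split=> [y|y|y z].
- by apply: val_inj; rewrite /= fK.
- by apply: val_inj; rewrite /= gK.
- exact: fP.
Qed.

End Transfer.

Lemma tree_typeSS n N T : tree_type n.+2 N T =
  [/\ is_tree T,
      has_rank T n.+2,
      has_size [set x : T | level x 1 /\ tree_type n.+1 Omega (subtree x)] N,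
      forall k, has_size
        [set x : T | level x 1 /\ tree_type n.+1 (Fin k) (subtree x)] Omega
    & forall x : T, level x 1 -> exists N', tree_type n.+1 N' (subtree x)].
Proof. by []. Qed.

Lemma tree_type_isom n N S T : isom S T -> tree_type n N S -> tree_type n N T.
Proof.
elim: n N S T => [//|n IH] N S T [f [g fg]].
have [fK gK _] := fg.
have sub x N' : tree_type n N' (subtree x) <-> tree_type n N' (subtree (f x)).
  have e := iso_subtree fg x; split; apply: IH => //; exact: isom_sym.
have lev N' : [set x : S | level x 1 /\ tree_type n N' (subtree x)] #=
    [set x : T | level x 1 /\ tree_type n N' (subtree x)].
  by apply: (card_bij_on fK gK) => x /=; rewrite (iso_level fg) sub.
case: n IH sub lev => [_ _ _|n IH sub lev].
  move=> [tr [k k1 rk] [r rr sz]]; split; first exact: iso_is_tree fg tr.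
    by exists k => //; apply: iso_has_rank fg _ rk.
  exists (f r); first exact/(iso_root fg).
  apply: has_size_card sz; apply: (card_bij_on fK gK) => x /=.
  exact: (iso_imm_succ fg).
rewrite !tree_typeSS => -[tr rk szN szk ex]; split.
- exact: iso_is_tree fg tr.
- exact: iso_has_rank fg _ rk.
- exact: has_size_card (lev Omega) szN.
- by move=> k; apply: has_size_card (lev (Fin k)) (szk k).
move=> x; rewrite -[x]gK => /(iso_level fg)/ex[N' N'P].
by exists N'; apply/sub.
Qed.

(** * Uniqueness of tree types *)

Lemma root_uniq (T : structure) (r r' : T) :
  is_tree T -> is_root r -> is_root r' -> r = r'.
Proof.
move=> [[irr tr] _ _ _ _] rr rr'; case: (rr r') => // h.
by case: (rr' r) => // h'; case: (irr r); apply: tr h h'.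
Qed.

Lemma tree_type_uniq n N N' T : tree_type n N T -> tree_type n N' T -> N = N'.
Proof.
case: n => [//|[|n]]; last first.
  by rewrite !tree_typeSS => -[_ _ h _ _] [_ _ h' _ _]; apply: has_size_uniq h h'.
move=> [tr _ [r rr h]] [_ _ [r' rr' h']].
by rewrite (root_uniq tr rr' rr) in h'; apply: has_size_uniq h h'.
Qed.

(** The number of predecessors is such a measure, by transitivity. *)
Lemma tree_measure (T : structure) : is_tree T ->
  exists mu : T -> nat, forall x y, prec x y -> mu x < mu y.
Proof.
move=> [[irr tr] fin _ _ _].
exists (fun x => #|` fset_set ([set y | prec y x] : set {classic T})|) => x y xy.
have mem z t : (z \in fset_set ([set y | prec y t] : set {classic T})) =
    (z \in ([set y | prec y t] : set {classic T})).
  by rewrite in_fset_set //; case: (fin t).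
apply: fproper_ltn_card; rewrite fproperEneq; apply/andP; split.
  apply/eqP => /fsetP/(_ x); rewrite !mem => e.
  by apply: (irr x); have /set_mem : x \in [set z : {classic T} | prec z x]
    by rewrite e; apply/mem_set.
apply/fsubsetP => z; rewrite !mem => /set_mem zx; apply/mem_set; exact: tr zx xy.
Qed.

(** An element between [x] and [y] that minimises the measure is an immediate
    successor of [x]. *)
Lemma imm_succ_below (T : structure) (x y : T) : is_tree T -> prec x y ->
  exists2 z, imm_succ x z & z = y \/ prec z y.
Proof.
move=> trT; have [mu muP] := tree_measure trT; have [[irr tr] _ _ _ _] := trT.
move: {2}(mu y) (leqnn (mu y)) => n; elim: n y => [|n IH] y yn xy.
  by have := muP _ _ xy; move: yn; rewrite leqn0 => /eqP->.
have [[z [xz zy]]|no] := pselect (exists z, prec x z /\ prec z y); last first.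
  by exists y => //; left.
have [|t xt tz] := IH z _ xz; first by rewrite -ltnS (leq_trans (muP _ _ zy)).
by exists t => //; right; case: tz => [->//|tz]; apply: tr tz zy.
Qed.

Lemma level1P (T : structure) (r x : T) : is_tree T -> is_root r ->
  level x 1 <-> imm_succ r x.
Proof.
move=> trT rr; have [[irr tr] fin _ _ _] := trT; split=> [lx|[rx no]].
  have rx : prec r x.
    case: (rr x) lx => // ->; rewrite /level.
    suff -> : [set y | prec y r] = set0.
      rewrite card_eq_sym card_eq0 => /eqP e.
      by have : `I_1 0 by []; rewrite e.
    apply/seteqP; split=> // y /= yr.
    case: (rr y) => [e|ry]; first by move: yr; rewrite e; apply: irr.
    by apply: (irr y); apply: tr yr ry.
  split=> // -[z [rz zx]].
  have /card_bijP[h [h' hK _]] := lx.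
  pose r1 : [set y | prec y x] := SigSub (mem_set rx : r \in [set y | prec y x]).
  pose z1 : [set y | prec y x] := SigSub (mem_set zx : z \in [set y | prec y x]).
  have one (u v : `I_1) : u = v.
    apply: val_inj; have := set_valP u; have := set_valP v.
    by rewrite /= !ltnS !leqn0 => /eqP-> /eqP->.
  have /(congr1 val)/= e := can_inj hK (one (h r1) (h z1)).
  by move: rz; rewrite e; apply: irr.
rewrite /level; suff -> : [set y | prec y x] = [set r] by apply: card_set1.
apply/seteqP; split=> y /= => [yx|->//].
by case: (rr y) => // ry; case: no; exists y.
Qed.

Lemma level1_below (T : structure) (r x : T) : is_tree T -> is_root r -> x <> r ->
  exists2 z, imm_succ r z & x = z \/ prec z x.
Proof.
move=> trT rr xr; case: (rr x) => // /(imm_succ_below trT)[z rz zx].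
by exists z => //; case: zx => [->|]; [left|right].
Qed.

Lemma level1_below_uniq (T : structure) (r x z z' : T) : is_tree T ->
  imm_succ r z -> imm_succ r z' -> x = z \/ prec z x -> x = z' \/ prec z' x ->
  z = z'.
Proof.
move=> trT [rz noz] [rz' noz']; have [_ fin _ _ _] := trT.
case=> [xz|zx] [xz'|zx'].
- by rewrite -xz.
- by case: noz; exists z'; rewrite -xz.
- by case: noz'; exists z; rewrite -xz'.
have [_ lin] := fin x; case: (lin _ _ zx zx') => // h.
  by case: noz'; exists z.
by case: noz; exists z'.
Qed.

(** Mutually inverse bijections between two subsets, given by total functions so
    that no dependent types appear when isomorphisms are glued. *)
Definition bij_on (S T : Type) (E : set S) (E' : set T) (f : S -> T) (g : T -> S) :=
  (forall x, E x -> E' (f x) /\ g (f x) = x) /\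
  (forall y, E' y -> E (g y) /\ f (g y) = y).

Lemma card_eq_bij_on (S T : Type) (E : set S) (E' : set T) (s : S) (t : T) :
  E #= E' -> exists f g, bij_on E E' f g.
Proof.
move=> /card_bijP[F [G FK GK]].
exists (fun x => if pselect (E x) is left p then val (F (SigSub (mem_set p))) else t).
exists (fun y => if pselect (E' y) is left p then val (G (SigSub (mem_set p))) else s).
split=> [x Ex|y Ey].
  case: pselect => // p; split; first exact: set_valP.
  case: pselect => [q|[]]; last exact: set_valP.
  by rewrite (_ : SigSub _ = F (SigSub (mem_set p))) ?FK //; apply: val_inj.
case: pselect => // p; split; first exact: set_valP.
case: pselect => [q|[]]; last exact: set_valP.
by rewrite (_ : SigSub _ = G (SigSub (mem_set p))) ?GK //; apply: val_inj.
Qed.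

(** The fibres partition both sets, so bijections chosen fibre by fibre fit
    together. *)
Lemma bij_on_fibres (S T K : Type) (E : set S) (E' : set T) (s : S) (t : T)
    (c : S -> K) (c' : T -> K) :
  (forall k, [set x | E x /\ c x = k] #= [set y | E' y /\ c' y = k]) ->
  exists f g, bij_on E E' f g /\ forall x, E x -> c' (f x) = c x.
Proof.
move=> ek.
have /choice[F FP] : forall k, exists fg : (S -> T) * (T -> S),
    bij_on [set x | E x /\ c x = k] [set y | E' y /\ c' y = k] fg.1 fg.2.
  by move=> k; have [f [g fg]] := card_eq_bij_on s t (ek k); exists (f, g).
have fP x : E x -> [/\ E' ((F (c x)).1 x), c' ((F (c x)).1 x) = c x
    & (F (c x)).2 ((F (c x)).1 x) = x].
  by move=> Ex; have [/(_ x)[//|[]]] := FP (c x).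
have gP y : E' y -> [/\ E ((F (c' y)).2 y), c ((F (c' y)).2 y) = c' y
    & (F (c' y)).1 ((F (c' y)).2 y) = y].
  by move=> Ey; have [_ /(_ y)[//|[]]] := FP (c' y).
exists (fun x => (F (c x)).1 x), (fun y => (F (c' y)).2 y); split; last first.
  by move=> x /fP[].
by split=> [x /fP[]|y /gP[]] h1 -> h2.
Qed.

Definition above (T : structure) (x y : T) : Prop := y = x \/ prec x y.

(** An isomorphism of the subtrees of [x] and [y], given by functions on the
    whole trees. *)
Definition local_iso (S T : structure) (x : S) (y : T) (f : S -> T) (g : T -> S) :=
  bij_on (above x) (above y) f g /\
  forall z z', above x z -> above x z' -> (prec z z' <-> prec (f z) (f z')).

Lemma isom_local_iso (S T : structure) (x : S) (y : T) :
  isom (subtree x) (subtree y) -> exists f g, local_iso x y f g.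
Proof.
move=> [F [G [FK GK FP]]].
exists (fun z =>
  if pselect (above x z) is left p then val (F (SigSub (mem_set p))) else y).
exists (fun z =>
  if pselect (above y z) is left p then val (G (SigSub (mem_set p))) else x).
split; first split=> [z xz|z yz].
- case: pselect => // p; split; first exact: (set_valP (F _)).
  case: pselect => [q|[]]; last exact: (set_valP (F _)).
  by rewrite (_ : SigSub _ = F (SigSub (mem_set p))) ?FK //; apply: val_inj.
- case: pselect => // p; split; first exact: (set_valP (G _)).
  case: pselect => [q|[]]; last exact: (set_valP (G _)).
  by rewrite (_ : SigSub _ = G (SigSub (mem_set p))) ?GK //; apply: val_inj.
move=> z z' xz xz'; case: pselect => // p; case: pselect => // p'.
exact: (FP (SigSub (mem_set p)) (SigSub (mem_set p'))).
Qed.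

Lemma above_level1 (T : structure) (r z x : T) : is_tree T ->
  imm_succ r z -> above z x -> prec r x.
Proof.
move=> [[_ tr] _ _ _ _] [rz _] [->//|zx]; exact: tr rz zx.
Qed.

(** Outside the root, a tree is the disjoint union of the subtrees above the
    children of the root, and elements of different subtrees are
    incomparable; so a bijection of the children and isomorphisms of the subtrees
    are all that is needed. *)
Lemma isom_glue (S T : structure) (r : S) (r' : T) (s : S -> T) (t : T -> S) :
  is_tree S -> is_tree T -> is_root r -> is_root r' ->
  bij_on (imm_succ r) (imm_succ r') s t ->
  (forall x, imm_succ r x -> isom (subtree x) (subtree (s x))) ->
  isom S T.
Proof.
move=> trS trT rr rr' [sP tP] sub.
have [[irrS transS] _ _ _ _] := trS; have [[irrT transT] _ _ _ _] := trT.
have /choice[F FP] : forall z, exists fg : (S -> T) * (T -> S),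
    imm_succ r z -> local_iso z (s z) fg.1 fg.2.
  move=> z; have [rz|nrz] := pselect (imm_succ r z); last first.
    by exists (s, t) => /nrz.
  by have [f [g fg]] := isom_local_iso (sub z rz); exists (f, g).
have /choice[p pP] : forall x, exists z, x <> r -> imm_succ r z /\ above z x.
  move=> x; have [->|xr] := pselect (x = r); first by exists r.
  by have [z rz zx] := level1_below trS rr xr; exists z.
have /choice[q qP] : forall x, exists z, x <> r' -> imm_succ r' z /\ above z x.
  move=> x; have [->|xr] := pselect (x = r'); first by exists r'.
  by have [z rz zx] := level1_below trT rr' xr; exists z.
pose f x := if pselect (x = r) is left _ then r' else (F (p x)).1 x.
pose g y := if pselect (y = r') is left _ then r else (F (t (q y))).2 y.
have fr : f r = r' by rewrite /f; case: pselect.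
have gr : g r' = r by rewrite /g; case: pselect.
have fE x : x <> r -> [/\ f x = (F (p x)).1 x, above (s (p x)) (f x),
    f x <> r' & q (f x) = s (p x)].
  move=> xr; have fx : f x = (F (p x)).1 x by rewrite /f; case: pselect.
  have [rp px] := pP x xr; have [rsp _] := sP _ rp.
  have [[/(_ x px)[fab _] _] _] := FP _ rp; rewrite -fx in fab.
  have fr' : f x <> r'.
    by move=> e; have := above_level1 trT rsp fab; rewrite e; apply: irrT.
  have [rq qx] := qP _ fr'; split=> //.
  exact: level1_below_uniq trT rq rsp qx fab.
have gE y : y <> r' -> [/\ g y = (F (t (q y))).2 y, above (t (q y)) (g y),
    g y <> r & p (g y) = t (q y)].
  move=> yr; have gy : g y = (F (t (q y))).2 y by rewrite /g; case: pselect.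
  have [rq qy] := qP y yr; have [rtq stq] := tP _ rq.
  have [[_ h] _] := FP _ rtq; rewrite stq in h; have [gab _] := h _ qy.
  rewrite -gy in gab.
  have gr' : g y <> r.
    by move=> e; have := above_level1 trS rtq gab; rewrite e; apply: irrS.
  have [rp px] := pP _ gr'; split=> //.
  exact: level1_below_uniq trS rp rtq px gab.
exists f, g; split=> [x|y|x y].
- have [->|xr] := pselect (x = r); first by rewrite fr gr.
  have [fx fab fr' qf] := fE x xr; have [gfx _ _ _] := gE _ fr'.
  have [rp px] := pP x xr; have [_ tsp] := sP _ rp.
  have [[/(_ x px)[_ h] _] _] := FP _ rp.
  by rewrite gfx qf tsp fx.
- have [->|yr] := pselect (y = r'); first by rewrite gr fr.
  have [gy gab gr' pg] := gE y yr; have [fgy _ _ _] := fE _ gr'.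
  have [rq qy] := qP y yr; have [rtq stq] := tP _ rq.
  have [[_ h] _] := FP _ rtq; rewrite stq in h; have [_ e] := h _ qy.
  by rewrite fgy pg gy.
have [->|xr] := pselect (x = r); have [->|yr] := pselect (y = r).
- by rewrite fr; split=> [/irrS|/irrT].
- have [_ _ fr' _] := fE y yr; rewrite fr; split=> _.
    by case: (rr' (f y)).
  by case: (rr y).
- have [_ _ fr' _] := fE x xr; rewrite fr; split=> h.
    by case: (rr x) => // h'; case: (irrS x); apply: transS h h'.
  by case: (rr' (f x)) => // h'; case: (irrT (f x)); apply: transT h h'.
have [fx fabx _ qfx] := fE x xr; have [fy faby _ qfy] := fE y yr.
have [rpx px] := pP x xr; have [rpy py] := pP y yr.
have [rspx tspx] := sP _ rpx; have [rspy tspy] := sP _ rpy.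
have [pxy|npxy] := pselect (p x = p y).
  by rewrite fx fy -pxy; apply: (FP _ rpx).2; rewrite // pxy.
split=> h; case: npxy.
  apply: (level1_below_uniq trS rpx rpy _ py).
  by right; case: px => [<-//|px']; apply: transS px' h.
rewrite -tspx -tspy; congr t.
apply: (level1_below_uniq trT rspx rspy _ faby).
by right; case: fabx => [<-//|fpx]; apply: transT fpx h.
Qed.

Lemma rank_decreases (T : structure) (rk : T -> nat) : is_tree T ->
  (forall x, is_sup [set (rk y).+1 | y in [set y | imm_succ x y]] (rk x)) ->
  forall x y, prec x y -> rk y < rk x.
Proof.
move=> trT rkP; have [mu muP] := tree_measure trT.
have immP x y : imm_succ x y -> rk y < rk x.
  by move=> xy; have [h _] := rkP x; apply: h; exists y.
move=> x y xy; have [n] := ubnP (mu y - mu x); elim: n x xy => // n IH x xy.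
rewrite ltnS => yn; have [z xz [zy|zy]] := imm_succ_below trT xy.
  by rewrite -zy; apply: immP.
apply: ltn_trans (immP _ _ xz); apply: IH => //; apply: leq_trans yn.
have [xz' _] := xz; have h1 := muP _ _ xz'; have h2 := muP _ _ zy.
by apply: ltn_sub2l => //; apply: ltn_trans h1 h2.
Qed.

Lemma isom_singleton (S T : structure) (s : S) (t : T) :
  (forall x, x = s) -> (forall y, y = t) -> ~ prec s s -> ~ prec t t -> isom S T.
Proof.
move=> sP tP ns nt; exists (fun=> t), (fun=> s); split=> [x|y|x y].
- by rewrite (sP x).
- by rewrite (tP y).
- by rewrite (sP x) (sP y); split=> [/ns|/nt].
Qed.

(** A node above a child of the root would give the root a rank of at least 2. *)
Lemma rank1_child (T : structure) (r x : T) k : is_tree T -> is_root r ->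
  has_rank T k -> k <= 1 -> imm_succ r x -> forall y : subtree x, val y = x.
Proof.
move=> trT rr [rk [rkP [r' rr' rk']]] k1 [rx _] y.
have dec := rank_decreases trT rkP.
have [//|/dec xy] := set_valP y.
have := leq_trans (leq_ltn_trans (leq0n _) xy) (leqnn _).
move/(fun h => leq_ltn_trans h (dec _ _ rx)).
by rewrite (root_uniq trT rr rr') rk' ltnNge k1.
Qed.

(** The nodes of level one are matched according to the types of the subtrees
    that they span; subtrees of the same type are isomorphic by induction. *)
Theorem tree_type_unique n N (S T : structure) :
  tree_type n N S -> tree_type n N T -> isom S T.
Proof.
elim: n N S T => [//|[_|n IH]] N S T.
  move=> [trS [k k1 rkS] [r rr szS]] [trT [k' k1' rkT] [r' rr' szT]].
  have [s [t st]] := card_eq_bij_on r r' (has_size_card_eq szS szT).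
  apply: (isom_glue trS trT rr rr' st) => x rx.
  have [rsx _] := st.1 x rx.
  have mx : x \in [set y | y = x \/ prec x y] by apply/mem_set; left.
  have msx : s x \in [set y | y = s x \/ prec (s x) y] by apply/mem_set; left.
  have [[irrS _] _ _ _ _] := trS; have [[irrT _] _ _ _ _] := trT.
  apply: (@isom_singleton (subtree x) (subtree (s x)) (SigSub mx) (SigSub msx)).
  - by move=> y; apply: val_inj; apply: (rank1_child trS rr rkS k1 rx).
  - by move=> y; apply: val_inj; apply: (rank1_child trT rr' rkT k1' rsx).
  - exact: irrS.
  - exact: irrT.
rewrite !tree_typeSS => -[trS _ szS szkS exS] [trT _ szT szkT exT].
have [_ _ [r rr] _ _] := trS; have [_ _ [r' rr'] _ _] := trT.
have /choice[c cP] : forall x : S, exists N',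
    level x 1 -> tree_type n.+1 N' (subtree x).
  move=> x; have [/exS[N' h]|nx] := pselect (level x 1); first by exists N'.
  by exists Omega => /nx.
have /choice[c' cP'] : forall x : T, exists N',
    level x 1 -> tree_type n.+1 N' (subtree x).
  move=> x; have [/exT[N' h]|nx] := pselect (level x 1); first by exists N'.
  by exists Omega => /nx.
have [|s [t [st cst]]] := @bij_on_fibres S T _ (imm_succ r) (imm_succ r') r r' c c'.
  move=> N'.
  have -> : [set x | imm_succ r x /\ c x = N'] =
      [set x | level x 1 /\ tree_type n.+1 N' (subtree x)].
    apply/seteqP; split=> x /= [lx h].
      have lx1 := (level1P x trS rr).2 lx.
      by split=> //; rewrite -h; apply: cP.
    split; first exact/(level1P x trS rr).
    by apply: tree_type_uniq (cP _ lx) h.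
  have -> : [set x | imm_succ r' x /\ c' x = N'] =
      [set x | level x 1 /\ tree_type n.+1 N' (subtree x)].
    apply/seteqP; split=> x /= [lx h].
      have lx1 := (level1P x trT rr').2 lx.
      by split=> //; rewrite -h; apply: cP'.
    split; first exact/(level1P x trT rr').
    by apply: tree_type_uniq (cP' _ lx) h.
  case: N' => [k|]; first exact: has_size_card_eq (szkS k) (szkT k).
  exact: has_size_card_eq szS szT.
apply: (isom_glue trS trT rr rr' st) => x rx; apply: (IH (c x)).
  by apply: cP; apply/(level1P _ trS rr).
rewrite -(cst x rx); apply: cP'.
by apply/(level1P _ trT rr'); case: (st.1 x rx).
Qed.

(** * Trees of finite sequences *)

(** A number [e] is the seed of a tree of every height [n]. The seed [std 0]
    yields the tree of type [n : omega] and [std k.+1] the one of type [n : k];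
    the seed [node x] yields a tree whose type depends on [nested_inf n Q x].
    This makes sense at height 0 too, if the type [0 : omega] is read as a single
    node and the types [0 : k] as the absence of a node. *)
Definition std (p : nat) : nat := cpair 1 p.
Definition node (x : nat) : nat := cpair 0 x.

(** The child with number [cpair a.+1 b] has the seed [std a.+1]; these are the
    infinitely many children of every finite type. The children [cpair 0 b] are
    the ones to be counted: for [node x] they carry the values of the quantified
    variable, for [std p] the right number of them gets the type [omega] and the
    others are turned into padding. *)
Definition child (e j : nat) : nat :=
  if p1 j == 0 then
    if p1 e == 0 then node (cpair (p2 e) (p2 j)) else
    if (p2 e == 0) || (p2 j < (p2 e).-1) then std 0 else std 1
  else std (p1 j).

Definition present (Q : set nat) (e : nat) : bool :=
  if p1 e == 0 then p2 e \in Q else p2 e == 0.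

(** The type of the tree of height [n] with seed [e], computed by counting
    children of type [omega]; a relation, since this is not effective. *)
Fixpoint ftype (Q : set nat) (n e : nat) (N : size_omega) : Prop :=
  if n is n'.+1 then has_size [set j | ftype Q n' (child e j) Omega] N
  else N = if present Q e then Omega else Fin 0.

Lemma ftype_exists Q n e : exists N, ftype Q n e N.
Proof.
by case: n => [|n] /=; [eexists; reflexivity | apply: has_size_exists].
Qed.

Lemma ftype_uniq Q n e N N' : ftype Q n e N -> ftype Q n e N' -> N = N'.
Proof. by case: n => [/= -> ->//|n] /=; apply: has_size_uniq. Qed.

Lemma child_first x b : child (node x) (cpair 0 b) = node (cpair x b).
Proof. by rewrite /child /node !(p1E, p2E). Qed.

Lemma child_pad e a b : child e (cpair a.+1 b) = std a.+1.
Proof. by rewrite /child !(p1E, p2E). Qed.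

Lemma child_std p b : child (std p) (cpair 0 b) =
  if (p == 0) || (b < p.-1) then std 0 else std 1.
Proof. by rewrite /child /std !(p1E, p2E). Qed.

(** Padding nodes are never of type [Omega], so only the children
    [cpair 0 b] are counted. *)
Lemma ftype_std Q n :
  [/\ ftype Q n (std 0) Omega,
      forall k, 0 < n -> ftype Q n (std k.+1) (Fin k)
    & forall k, ~ ftype Q n (std k.+1) Omega].
Proof.
elim: n => [|n [IH0 _ IHk]].
  by split=> [|//|k]; rewrite /ftype /present /std !(p1E, p2E).
have cE p : [set j | ftype Q n (child (std p) j) Omega] =
    cpair 0 @` [set b | (p == 0) || (b < p.-1)].
  apply/seteqP; split=> [j|_ [b /= pb <-]]; last by rewrite /= child_std pb.
  rewrite -[j]cpairK /=; case: (p1 j) => [|a]; last by rewrite child_pad => /IHk.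
  by rewrite child_std; case: ifP => [pb _|_ /IHk//]; exists (p2 j).
have cC p : [set b | (p == 0) || (b < p.-1)] #=
    [set j | ftype Q n (child (std p) j) Omega].
  rewrite cE; apply/card_esym/inj_card_eq => b b' _ _ e.
  by have [] := cpair_inj e.
have sk k : ftype Q n.+1 (std k.+1) (Fin k).
  by apply: (@has_size_card _ _ _ _ (Fin k) (cC k.+1)); apply: card_eqxx.
split=> [|//|k h].
  apply: (@has_size_card _ _ _ _ Omega (cC 0)); rewrite /=.
  by rewrite (_ : mkset _ = setT) //; apply/seteqP.
by have := ftype_uniq (sk k) h.
Qed.

Lemma inf_manyP P : inf_many P <-> [set n | P n] #= [set: nat].
Proof.
split=> [h|/card_esym e N].
  rewrite card_eq_le; apply/andP; split; first exact: countableP.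
  apply/infiniteP => /finite_seqP[X XP].
  have [n nX Pn] := h (\max_(i <- X) i).+1.
  have : n \in X by have : [set` X] n by rewrite -XP.
  by move=> nX'; have := @leq_bigmax_seq _ X xpredT id n nX' isT; rewrite leqNgt nX.
apply: contrapT => no; apply: infinite_nat.
rewrite (eq_finite_set e); apply: sub_finite_set (finite_II N) => n /= Pn.
by rewrite ltnNge; apply/negP => Nn; apply: no; exists n.
Qed.

(** The padding contributes no child of type [Omega], so that the definition of
    [ftype] unfolds to the nested infinity quantifiers. *)
Lemma ftype_node Q n x : ftype Q n (node x) Omega <-> nested_inf n Q x.
Proof.
elim: n x => [|n IH] x.
  rewrite /ftype /present /node !(p1E, p2E) /=; split; first by case: ifP => // /set_mem.
  by move=> /mem_set->.
have cE : [set j | ftype Q n (child (node x) j) Omega] =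
    cpair 0 @` [set b | nested_inf n Q (cpair x b)].
  apply/seteqP; split=> [j|_ [b /= pb <-]]; last by rewrite /= child_first IH.
  rewrite -[j]cpairK /=; case: (p1 j) => [|a].
    by rewrite child_first => /IH; exists (p2 j).
  by rewrite child_pad; case: (ftype_std Q n) => _ _ h /h.
have cC : [set j | ftype Q n (child (node x) j) Omega] #=
    [set b | nested_inf n Q (cpair x b)].
  by rewrite cE; apply: inj_card_eq => b b' _ _ e; have [] := cpair_inj e.
rewrite /= inf_manyP; split; apply: card_eq_trans => //.
exact: card_esym.
Qed.

(** The sequence lists the numbers of the children on the way from the root. *)
Fixpoint mem_tree (Q : set nat) (n e : nat) (s : seq nat) : bool :=
  match n, s with
  | 0, [::] => present Q e
  | 0, _ :: _ => false
  | n'.+1, [::] => true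
  | n'.+1, j :: s' => mem_tree Q n' (child e j) s'
  end.

Definition below (s t : seq nat) : Prop := exists j u, t = s ++ j :: u.

Definition seq_tree (Q : set nat) (n e : nat) : structure :=
  @substructure (Structure below) [set s | mem_tree Q n e s].

Lemma mem_tree_size Q n e s : mem_tree Q n e s -> size s <= n.
Proof. by elim: n e s => [|n IH] e [|j s] //= /IH. Qed.

Lemma mem_tree_below Q n e s t : below s t -> mem_tree Q n e t -> mem_tree Q n e s.
Proof.
move=> [j [u ->]]; elim: n e s => [|n IH] e [|i s] //=; exact: IH.
Qed.

Lemma below_size s t : below s t -> size s < size t.
Proof. by move=> [j [u ->]]; rewrite size_cat /= addnS ltnS leq_addr. Qed.

Lemma below_trans s t u : below s t -> below t u -> below s u.
Proof. by move=> [j [v ->]] [i [w ->]]; exists j, (v ++ i :: w); rewrite -catA. Qed.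

Lemma below_take s t : below s t -> s = take (size s) t.
Proof. by move=> [j [u ->]]; rewrite take_size_cat. Qed.

Lemma below_take_lt s t k : k < size t -> s = take k t -> below s t.
Proof.
move=> kt ->; rewrite -{2}[t](cat_take_drop k).
case e : (drop k t) => [|j u]; last by exists j, u.
by have := size_drop k t; rewrite e => /esym/eqP; rewrite subn_eq0 leqNgt kt.
Qed.

Section SeqTree.
Variables (Q : set nat) (n e : nat).

Definition seq_node s (sP : mem_tree Q n e s) : seq_tree Q n e :=
  SigSub (mem_set (sP : [set s | mem_tree Q n e s] s)).

Lemma seq_nodeP (x : seq_tree Q n e) : mem_tree Q n e (val x).
Proof. exact: (set_valP x). Qed.

Lemma seq_imm_succ (x y : seq_tree Q n e) :
  imm_succ x y <-> exists j, val y = rcons (val x) j.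
Proof.
split=> [[[j [u yE]] no]|[j yE]]; last first.
  split; first by exists j, [::]; rewrite yE cats1.
  move=> [z [/below_size xz /below_size zy]].
  by have := leq_ltn_trans xz zy; rewrite yE size_rcons ltnn.
exists j; rewrite yE -cats1; case: u yE => [//|i u yE]; case: no.
have b : below (rcons (val x) j) (val y).
  by exists i, u; rewrite yE -cats1 -catA.
exists (seq_node (mem_tree_below b (seq_nodeP y))); split=> //.
by exists j, [::]; rewrite cats1.
Qed.

End SeqTree.

Definition seq_root Q n e : seq_tree Q n.+1 e :=
  @seq_node Q n.+1 e [::] isT.

Lemma seq_rootP Q n e : is_root (seq_root Q n e).
Proof.
move=> x; case xE : (val x) => [|j s]; first by left; apply: val_inj; rewrite xE.
by right; exists j, s; rewrite xE.
Qed.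

Lemma seq_tree_is_tree Q n e : is_tree (seq_tree Q n.+1 e).
Proof.
split.
- split=> [x /below_size|x y z]; [by rewrite ltnn | exact: below_trans].
- move=> x; split.
    pose f k : seq_tree Q n.+1 e := if pselect (mem_tree Q n.+1 e (take k (val x)))
      is left p then seq_node p else seq_root Q n e.
    apply: (@sub_finite_set _ _ (f @` `I_(size (val x)))); last exact: finite_image.
    move=> y /= yx; have yE := below_take yx.
    exists (size (val y)); first exact: below_size.
    apply: val_inj; rewrite /f; case: pselect => [p /=|[]]; first by rewrite -yE.
    by rewrite -yE; apply: seq_nodeP.
  move=> y z /[dup] /below_take yE /below_size ys /[dup] /below_take zE /below_size zs.
  have take2 k l : k < l -> l < size (val x) ->
      below (take k (val x)) (take l (val x)).
    move=> kl lx; apply: (@below_take_lt _ _ k).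
      by rewrite size_take lx.
    by rewrite take_takel // ltnW.
  case: (ltngtP (size (val y)) (size (val z))) => h.
  + by apply: Or31; rewrite /= yE zE; apply: take2.
  + by apply: Or33; rewrite /= yE zE; apply: take2.
  + by apply: Or32; apply: val_inj; rewrite yE zE h.
- by exists (seq_root Q n e); apply: seq_rootP.
- apply/countable_injP; exists (fun x => choice.pickle (val x : seq nat)) => x y _ _.
  by move=> /(pcan_inj choice.pickleK)/val_inj.
move=> [p pP].
have grow i : i <= size (val (p i)).
  elim: i => // i IH; have [/below_size h _] := pP i.
  exact: leq_ltn_trans IH h.
by have := leq_trans (grow n.+2) (mem_tree_size (seq_nodeP (p n.+2))); rewrite ltnn.
Qed.

(** Trees of height at least 2 have full rank; for height 1 the rank depends on
    the presence of children. *)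
Fixpoint seq_rank (Q : set nat) (n e : nat) (s : seq nat) : nat :=
  match n, s with
  | 0, _ => 0
  | 1, [::] => `[< exists j, present Q (child e j) >]
  | n'.+1, [::] => n'.+1
  | n'.+1, j :: s' => seq_rank Q n' (child e j) s'
  end.

Lemma seq_rank_cons Q n e j s :
  seq_rank Q n.+1 e (j :: s) = seq_rank Q n (child e j) s.
Proof. by case: n. Qed.

Lemma seq_rank_le Q n e s : seq_rank Q n e s <= n.
Proof.
elim: n e s => [|n IH] e [|j s] //; last by rewrite seq_rank_cons ltnW ?ltnS.
by case: n IH => [|n] _ //=; apply: leq_b1.
Qed.

(** A child with seed [std 2], of type [Fin 1], has full rank even at height 1,
    which gives full rank to the trees of height at least 2. *)
Lemma seq_rank_pad Q n e : seq_rank Q n (child e (cpair 2 0)) [::] = n.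
Proof.
case: n => [|[|n]] //=; case: asboolP => // -[]; exists (cpair 0 0).
by rewrite child_pad child_std /= /present /std !(p1E, p2E).
Qed.

Arguments seq_rank : simpl never.

Lemma seq_rankP Q n e s : mem_tree Q n e s ->
  is_sup [set k | exists2 j, mem_tree Q n e (rcons s j) &
            k = (seq_rank Q n e (rcons s j)).+1]
    (seq_rank Q n e s).
Proof.
elim: n e s => [|n IH] e [|i s] //=.
- by move=> _; split=> // k [].
- move=> _; split=> [k [j jP ->]|t tP].
    rewrite seq_rank_cons; case: n IH jP => [_ /= jP|n _ _].
      by rewrite /seq_rank lt0b; apply/asboolP; exists j.
    exact: seq_rank_le.
  case: n IH tP => [|n] _ tP.
    by rewrite /seq_rank; case: asboolP => // -[j jP]; apply: tP; exists j.
  have := tP n.+2; apply; exists (cpair 2 0) => //.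
  by rewrite seq_rank_cons seq_rank_pad.
move=> /IH[ub lub]; rewrite seq_rank_cons; split=> [k [j jP ->]|t tP].
  by rewrite seq_rank_cons; apply: ub; exists j.
apply: lub => k [j jP ->]; apply: tP; exists j => //.
by rewrite seq_rank_cons.
Qed.

Lemma seq_tree_has_rank Q n e : has_rank (seq_tree Q n.+1 e) (seq_rank Q n.+1 e [::]).
Proof.
exists (fun x => seq_rank Q n.+1 e (val x)); split=> [x|].
  suff -> : [set (seq_rank Q n.+1 e (val y)).+1 | y in [set y | imm_succ x y]] =
    [set k | exists2 j, mem_tree Q n.+1 e (rcons (val x) j) &
       k = (seq_rank Q n.+1 e (rcons (val x) j)).+1].
    exact/seq_rankP/seq_nodeP.
  apply/seteqP; split=> [_ [y /= /seq_imm_succ[j yE] <-]|k [j jP ->]].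
    by exists j; rewrite -yE //; exact: (seq_nodeP y).
  by exists (seq_node jP) => //=; apply/seq_imm_succ; exists j.
by exists (seq_root Q n e); first exact: seq_rootP.
Qed.

Lemma seq_tree_level1 Q n e (x : seq_tree Q n.+1 e) :
  level x 1 <-> exists j, val x = [:: j].
Proof.
rewrite (level1P x (seq_tree_is_tree Q n e) (@seq_rootP Q n e)).
exact: seq_imm_succ.
Qed.

(** Removing the first entry is an isomorphism. *)
Lemma seq_tree_subtree Q n e j (x : seq_tree Q n.+1 e) : val x = [:: j] ->
  isom (seq_tree Q n (child e j)) (subtree x).
Proof.
move=> xE.
have mf (s : seq_tree Q n (child e j)) : mem_tree Q n.+1 e (j :: val s).
  exact: seq_nodeP s.
have mf' (s : seq_tree Q n (child e j)) :
    seq_node (mf s) \in [set y | y = x \/ prec x y].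
  apply/mem_set.
  have [sE|[i [u sE]]] : val s = [::] \/ exists i u, val s = i :: u.
  - by case: (val s) => [|i u]; [left | right; exists i, u].
  - by left; apply: val_inj; rewrite /= xE sE.
  - by right; exists i, u; rewrite /= xE sE.
have valE (y : subtree x) : val (val y) = j :: behead (val (val y)).
  by have [->|[i [u yE]]] := set_valP y; rewrite ?yE xE.
have mg (y : subtree x) : mem_tree Q n (child e j) (behead (val (val y))).
  by have := seq_nodeP (val y); rewrite valE.
exists (fun s => SigSub (mf' s)), (fun y => seq_node (mg y)); split=> [s|y|s t].
- exact: val_inj.
- by apply: val_inj; apply: val_inj; rewrite /= -valE.
split=> -[i [u]] /= => [->|[->]]; by exists i, u.
Qed.

(** Level one is counted through the first entries of its members. *)
Lemma card_level1 Q n e (X : set (seq_tree Q n.+1 e)) (P : set nat) :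
  (forall j, P j -> mem_tree Q n.+1 e [:: j]) ->
  (forall x, X x <-> exists2 j, val x = [:: j] & P j) -> P #= X.
Proof.
move=> PM XP; have -> : P = (fun x => head 0 (val x)) @` X.
  apply/seteqP; split=> [j Pj|_ [x /XP[j xE Pj] <-]]; last by rewrite xE.
  by exists (seq_node (PM j Pj)) => //; apply/XP; exists j.
apply: inj_card_eq => x y /set_mem/XP[i xE _] /set_mem/XP[j yE _] /=.
by rewrite xE yE /= => ij; apply: val_inj; rewrite xE yE ij.
Qed.

(** A tree has one type only, so the type read off the seed decides which types
    the subtree has. *)
Lemma subtree_typeP Q n e j (x : seq_tree Q n.+2 e) N :
  (forall M, ftype Q n.+1 (child e j) M ->
     tree_type n.+1 M (seq_tree Q n.+1 (child e j))) ->
  val x = [:: j] ->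
  tree_type n.+1 N (subtree x) <-> ftype Q n.+1 (child e j) N.
Proof.
move=> typ /seq_tree_subtree i; split=> [h|/typ]; last exact: tree_type_isom.
have [M MP] := ftype_exists Q n.+1 (child e j).
by have <- := tree_type_uniq (tree_type_isom i (typ _ MP)) h.
Qed.

Lemma seq_tree_type Q n e N : ftype Q n.+1 e N ->
  tree_type n.+1 N (seq_tree Q n.+1 e).
Proof.
elim: n e N => [|n IH] e N eN.
  split; first exact: seq_tree_is_tree.
    exists (seq_rank Q 1 e [::]); first exact: seq_rank_le.
    exact: seq_tree_has_rank.
  exists (seq_root Q 0 e); first exact: seq_rootP.
  apply: has_size_card eN; apply: card_level1 => [j|x] /=; first by case: ifP.
  rewrite seq_imm_succ; split=> [[j xE]|[j xE _]]; last by exists j.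
  exists j => //; have := seq_nodeP x.
  by rewrite (xE : val x = [:: j]) /= => ->.
have sub j N' (x : seq_tree Q n.+2 e) : val x = [:: j] ->
    tree_type n.+1 N' (subtree x) <-> ftype Q n.+1 (child e j) N'.
  by apply: subtree_typeP => M; apply: IH.
have lev N' : [set j | ftype Q n.+1 (child e j) N'] #=
    [set x : seq_tree Q n.+2 e | level x 1 /\ tree_type n.+1 N' (subtree x)].
  apply: card_level1 => // x /=; split=> [[/seq_tree_level1[j xE]]|[j xE]].
    by move/(sub _ _ _ xE); exists j.
  by move/(sub _ _ _ xE) => h; split=> //; apply/seq_tree_level1; exists j.
rewrite tree_typeSS; split.
- exact: seq_tree_is_tree.
- exact: seq_tree_has_rank.
- exact: has_size_card (lev Omega) eN.
- move=> k; apply: has_size_card (lev (Fin k)) _; apply/inf_manyP => M.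
  exists (cpair k.+1 M); first exact: leq_cpair.
  by rewrite child_pad; have [_ h _] := ftype_std Q n.+1; apply: h.
move=> x /seq_tree_level1[j xE].
have [M MP] := ftype_exists Q n.+1 (child e j).
by exists M; apply/(sub _ _ _ xE).
Qed.

(** * Computable copies *)

Fixpoint enc (s : seq nat) : nat :=
  if s is j :: s' then (cpair j (enc s')).+1 else 0.

Lemma enc_inj : injective enc.
Proof.
elim=> [|i s IH] [|j t] //= [] /cpair_inj[->] /IH; by move=> ->.
Qed.

Lemma enc_surj x : exists s, enc s = x.
Proof.
elim/ltn_ind: x => -[_|x IH]; first by exists [::].
have [|s sE] := IH (p2 x); first by rewrite ltnS -{2}[x]cpairK leq_cpair.
by exists (p1 x :: s); rewrite /= sE cpairK.
Qed.

Fixpoint mem_code (Q : set nat) (n e x : nat) : bool :=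
  if n is n'.+1 then (x == 0) || mem_code Q n' (child e (p1 x.-1)) (p2 x.-1)
  else (x == 0) && present Q e.

Lemma mem_code_enc Q n e s : mem_code Q n e (enc s) = mem_tree Q n e s.
Proof. by elim: n e s => [|n IH] e [|j s] //=; rewrite p1E p2E IH. Qed.

(** The members of a tree have bounded length, which makes a recursion on the
    bound possible. *)
Fixpoint below_code (n x y : nat) : bool :=
  if n is n'.+1 then
    (y != 0) && ((x == 0) ||
      ((p1 x.-1 == p1 y.-1) && below_code n' (p2 x.-1) (p2 y.-1)))
  else false.

Lemma below_codeP n s t : size t <= n ->
  below_code n (enc s) (enc t) <-> below s t.
Proof.
elim: n s t => [|n IH] s t.
  by rewrite leqn0 => /nilP->; split=> // /below_size.
case: t => [|j t] /= tn; first by split=> // /below_size.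
case: s => [|i s] /=; first by split=> // _; exists j, t.
rewrite !(p1E, p2E); split=> [/andP[/eqP-> /IH[//|k [u ->]]]|[k [u [-> tE]]]].
  by exists k, u.
by rewrite eqxx; apply/IH => //; exists k, u.
Qed.

Lemma computable_child Z :
  computable Z (fun w => child (p1 w) (p2 w)).
Proof. by rewrite /child /node /std; computes. Qed.

Lemma computable_mem_code Q Z n : turing_le Q Z ->
  computable Z (fun w => nat_of_bool (mem_code Q n (p1 w) (p2 w))).
Proof.
move=> QZ; elim: n => [|n IH] /=; computes.
  have : computable Z (fun w => if p1 (p1 w) == 0 then
      nat_of_bool (p2 (p1 w) \in Q) else nat_of_bool (p2 (p1 w) == 0)).
    by computes; apply: computable_mem => //; computes.
  by apply: eq_computable => w; rewrite /present; case: ifP.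
apply: (computable_app2 (F := fun e x => nat_of_bool (mem_code Q n e x)) IH).
  by apply: (computable_app2 (computable_child Z)); computes.
by computes.
Qed.

Lemma computable_below_code Z n :
  computable Z (fun w => nat_of_bool (below_code n (p1 w) (p2 w))).
Proof.
elim: n => [|n IH] /=; computes.
by apply: (computable_app2 (F := fun x y => nat_of_bool (below_code n x y)) IH);
  computes.
Qed.

Definition omega_tree (Q : set nat) (n e : nat) : omega_structure :=
  OmegaStructure [set x | mem_code Q n e x] (fun x y => below_code n x y).

Lemma computable_omega_tree Q Z n e : turing_le Q Z ->
  computable_structure Z (omega_tree Q n e).
Proof.
move=> QZ; have memZ f : computable Z f ->
    computable Z (fun w => nat_of_bool (mem_code Q n e (f w))).
  move=> fZ; apply: (computable_app2 (F := fun e x => nat_of_bool (mem_code Q n e x)));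
    by [apply: computable_mem_code | apply: computable_const |].
split; first exact/turing_le_bool/memZ/computable_id.
rewrite (_ : mkset _ = [set w | [&& mem_code Q n e (p1 w), mem_code Q n e (p2 w)
    & below_code n (p1 w) (p2 w)]]).
  apply: turing_le_bool; computes; first by apply: memZ; computes.
    by apply: memZ; computes.
  exact: computable_below_code.
apply/seteqP; split=> [_ [x [y [-> xy]]]|w /= /and3P[xm ym xy]] /=.
  by rewrite p1E p2E xy andbT (set_valP x) (set_valP y).
exists (SigSub (mem_set (xm : [set x | mem_code Q n e x] (p1 w)))).
exists (SigSub (mem_set (ym : [set x | mem_code Q n e x] (p2 w)))).
by rewrite /= cpairK.
Qed.

Lemma bij_is_iso (S T : structure) (f : S -> T) : injective f ->
  (forall y, exists x, f x = y) -> (forall x y, prec x y <-> prec (f x) (f y)) ->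
  exists g, is_iso f g.
Proof.
move=> finj /choice[g gK] fP; exists g; split=> // x; exact: finj.
Qed.

Lemma omega_tree_iso Q n e :
  exists (f : seq_tree Q n e -> omega_tree Q n e) g,
    is_iso f g /\ forall x, val (f x) = enc (val x).
Proof.
have m (x : seq_tree Q n e) : [set y | mem_code Q n e y] (enc (val x)).
  by rewrite /= mem_code_enc; apply: seq_nodeP.
pose f (x : seq_tree Q n e) : omega_tree Q n e := SigSub (mem_set (m x)).
have [||x y|g fg] := @bij_is_iso _ _ f; last by exists f, g.
- by move=> x y /(congr1 val) /= /enc_inj; apply: val_inj.
- move=> y; have [s sE] := enc_surj (val y).
  have ms : mem_tree Q n e s by rewrite -mem_code_enc sE; exact: (set_valP y).
  by exists (seq_node ms); apply: val_inj.
apply: iff_sym; apply: below_codeP; exact: mem_tree_size (seq_nodeP y).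
Qed.

Lemma omega_tree_type Q n e N : ftype Q n.+1 e N ->
  tree_type n.+1 N (omega_tree Q n.+1 e).
Proof.
move/seq_tree_type; apply: tree_type_isom.
by have [f [g [fg _]]] := omega_tree_iso Q n.+1 e; exists f, g.
Qed.

(** The value of [enc] on a sequence of length one. *)
Definition level1_code (j : nat) : nat := (cpair j 0).+1.

Lemma omega_tree_level1 Q n e (x : omega_tree Q n.+1 e) :
  level x 1 <-> exists j, val x = level1_code j.
Proof.
have [f [g [fg fE]]] := omega_tree_iso Q n.+1 e; have [fK gK _] := fg.
rewrite -[x in level x 1]gK -[x in val x]gK fE -(iso_level fg) seq_tree_level1.
split=> -[j xE]; exists j; first by rewrite xE.
exact: enc_inj.
Qed.

Lemma omega_tree_level1_code Q n e j :
  exists x : omega_tree Q n.+2 e, val x = level1_code j.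
Proof.
have [f [_ [_ fE]]] := omega_tree_iso Q n.+2 e.
by exists (f (@seq_node Q n.+2 e [:: j] isT)); rewrite fE.
Qed.

Lemma omega_subtree_typeP Q n e j (x : omega_tree Q n.+2 e) N :
  val x = level1_code j ->
  tree_type n.+1 N (subtree x) <-> ftype Q n.+1 (child e j) N.
Proof.
have [f [g [fg fE]]] := omega_tree_iso Q n.+2 e; have [_ gK _] := fg.
rewrite -[x in val x]gK fE => /(@enc_inj _ [:: j]) xE.
have i := iso_subtree fg (g x); rewrite gK in i.
rewrite -(@subtree_typeP Q n e j (g x) N (fun M => @seq_tree_type _ _ _ M) xE).
by split; apply: tree_type_isom => //; apply: isom_sym.
Qed.

(** * Reading the jump off an isomorphism *)

(** Unbounded search, with the inner program computing the negation because
    [Cmu] looks for the value 0. *)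
Lemma computable_search X (b : nat -> bool) :
  computable X (fun w => nat_of_bool (b w)) ->
  (forall x, exists k, b (cpair x k)) ->
  exists2 h, computable X h & forall x, b (cpair x (h x)).
Proof.
move=> /computable_negb[c cP] ex.
pose h x := ex_minn (ex x).
have hb x : b (cpair x (h x)) by rewrite /h; case: ex_minnP.
have hmin x k : k < h x -> ~~ b (cpair x k).
  rewrite /h; case: ex_minnP => k' _ kmin; rewrite ltnNge.
  by apply: contra => /kmin.
have muP x d : d <= h x -> eval X (Cmu c) (cpair x (h x - d)) (h x).
  elim: d => [_|d IH dh].
    by rewrite subn0; apply: eval_mu_found; have := cP (cpair x (h x)); rewrite hb.
  apply: (@eval_mu_next _ _ _ _ 0); last first.
    by rewrite -subSn //= subSS; apply/IH/ltnW.
  have := cP (cpair x (h x - d.+1)); rewrite hmin //.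
  by rewrite ltn_subrL /= (leq_trans _ dh).
exists h => //.
have [c0 c0P] : computable X (fun x => cpair x 0) by computes.
exists (Ccomp (Cmu c) c0) => x; apply: eval_comp (c0P x) _.
by rewrite -[X in cpair x X](subnn (h x)); apply: muP.
Qed.

(** The tags of Goedel numbers are at most 8. *)
Lemma jump_coinfinite X : inf_many (fun e => ~ jump X e).
Proof.
move=> N; exists (cpair 9 N); first exact: leq_cpair.
by case=> c [v [cE _]]; case: c cE => [||||| a b | a b | a b | a] /cpair_inj[].
Qed.

Lemma child_std0_type Q n j :
  ftype Q n (child (std 0) j) Omega <-> p1 j = 0.
Proof.
have [h0 _ hk] := ftype_std Q n; rewrite -[j]cpairK p1E.
by case: (p1 j) => [|a]; rewrite ?child_std ?child_pad; split=> // /hk.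
Qed.

Theorem theorem7p3 (m : nat) (A : structure) (a : seq A) (Z : set nat) :
  1 <= m -> tree_type m.+1 Omega A ->
  exists (B C : omega_structure) (b : seq B) (c : seq C),
    [/\ computable_structure Z B /\ computable_structure Z C,
        isomorphic b a,
        isomorphic c a
      & forall f : B -> C, isomorphism b c f ->
          turing_le (iter_jump (2 * m) Z) (graph f)].
Proof.
case: m => // m _ typA.
have [Q QZ QP] := nested_inf_iter_jump Z m.
pose B := omega_tree Q m.+2 (std 0); pose C := omega_tree Q m.+2 (node 0).
have typB : tree_type m.+2 Omega B.
  by apply: omega_tree_type; case: (ftype_std Q m.+2).
have typC : tree_type m.+2 Omega C.
  apply: omega_tree_type; apply/ftype_node.
  apply/(eq_inf_many (fun x => QP x)); rewrite iter_jumpS2.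
  exact: jump_coinfinite.
have [b ba] := isom_isomorphic a (tree_type_unique typB typA).
have [c ca] := isom_isomorphic a (tree_type_unique typC typA).
exists B, C, b, c; split=> //; first by split; apply: computable_omega_tree.
move=> f /isomorphism_is_iso[g fg]; have [fK gK _] := fg.
pose y x := level1_code (cpair 0 x).
(* [h x] is the node of [B] that is mapped to the node [y x] of [C] *)
have [||h hX hP] := @computable_search (graph f)
  (fun w => cpair (p2 w) (y (p1 w)) \in graph f).
- apply: computable_mem; first exact: turing_le_refl.
  by rewrite /y /level1_code; computes.
- move=> x; have [z zE] := omega_tree_level1_code Q m (node 0) (cpair 0 x).
  exists (val (g z)); apply/mem_set; exists (g z).
  by rewrite !(p1E, p2E) gK zE.
have : computable (graph f) (fun x => nat_of_bool (~~ (p1 (p1 (h x).-1) == 0))).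
  by computes.
apply: eq_computable => x; congr nat_of_bool.
have /set_mem[z] := hP x; rewrite !(p1E, p2E) => /cpair_inj[hz yz].
have : level (f z) 1 by apply/omega_tree_level1; exists (cpair 0 x).
move/(iso_level fg)/omega_tree_level1 => [j zE].
have jP : p1 j = 0 <-> ~ iter_jump (2 * m.+1) Z x.
  rewrite QP -ftype_node -(child_std0_type Q m.+1) -child_first.
  rewrite -(omega_subtree_typeP Omega zE) -(omega_subtree_typeP Omega (esym yz)).
  have i := iso_subtree fg z; split; apply: tree_type_isom => //.
  exact: isom_sym.
rewrite hz zE p1E; apply/idP/idP => [/eqP jn|/set_mem xJ].
  by apply/mem_set; apply: contrapT => /jP.
by apply/eqP => /jP.
Qed.
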